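(* Let $X$ be an infinite-dimensional real Banach space and let $p\in\{1,2,\dots\}\cup\{\infty\}$. If $X$ admits a $C^p$ smooth bump function, then there exists a $C^p$ smooth bump function $f:X\to[0,1]$ such that $f'(x)\neq 0$ for every $x\in\operatorname{int}(\operatorname{supp} f)$. Moreover, if $X$ admits a $C^p$ smooth Lipschitz bump function, then $f$ can be chosen to be, in addition, Lipschitz.
   Context: A bump function on $X$ is a function $b:X\to\mathbb{R}$ which is not identically zero and has bounded support, where $\operatorname{supp} b=\overline{\{x\in X: b(x)\neq 0\}}$. ''$C^p$ smooth'' refers to Fréchet differentiability of order $p$ with continuous $p$-th derivative; $f'(x)\in X^*$ denotes the Fréchet derivative. *)

(* Defs.v *)
From HB Require Import structures.
From mathcomp Require Import all_boot all_order all_algebra.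
From mathcomp Require Import all_classical all_reals all_analysis.
Set Implicit Arguments. Unset Strict Implicit. Unset Printing Implicit Defensive.
Import Order.TTheory GRing.Theory Num.Theory.
Import numFieldNormedType.Exports.
Local Open Scope classical_set_scope.
Local Open Scope ring_scope.

Inductive smooth_order := Fin of nat | Inf.

Definition le_order (k : nat) (p : smooth_order) : bool :=
  match p with Fin n => (k <= n)%N | Inf => true end.

Definition valid_order (p : smooth_order) : Prop :=
  match p with Fin n => (1 <= n)%N | Inf => True end.

Section Defs.
Context {R : realType} {X : normedModType R}.

(* A k-ary form on X is represented as a function on lists of vectors,
   only its values on lists of length k matter. *)

Definition multilinear (k : nat) (L : seq X -> R) : Prop :=
  forall (s t : seq X), (size s + size t).+1 = k ->
    forall (a : R) (y z : X),
      L (s ++ (a *: y + z) :: t) = a * L (s ++ y :: t) + L (s ++ z :: t).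

Definition bounded_multilinear (k : nat) (L : seq X -> R) : Prop :=
  multilinear k L /\
  exists C : R, forall v : seq X, size v = k ->
    `|L v| <= C * \prod_(y <- v) `|y|.

Definition unit_list (k : nat) (v : seq X) : Prop :=
  size v = k /\ forall y, y \in v -> `|y| <= 1.

(* D (k.+1) x is the Frechet derivative at x of the map y |-> D k y,
   with values in the Banach space of bounded k-linear forms (operator norm):
   ||D k (x+h) - D k x - D (k.+1) x (h, .)||_op = o(||h||). *)
Definition frechet_step (D : nat -> X -> seq X -> R) (k : nat) (x : X) : Prop :=
  forall eps : R, 0 < eps -> exists delta : R, 0 < delta /\
    forall h : X, `|h| < delta -> forall v : seq X, unit_list k v ->
      `|D k (x + h) v - D k x v - D k.+1 x (h :: v)| <= eps * `|h|.

Definition op_continuous (D : nat -> X -> seq X -> R) (k : nat) (x : X) : Prop :=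
  forall eps : R, 0 < eps -> exists delta : R, 0 < delta /\
    forall y : X, `|y - x| < delta -> forall v : seq X, unit_list k v ->
      `|D k y v - D k x v| <= eps.

Definition Cp_smooth (p : smooth_order) (f : X -> R) : Prop :=
  exists D : nat -> X -> seq X -> R,
    (forall x, D 0%N x [::] = f x) /\
    (forall k x, le_order k p -> bounded_multilinear k (D k x)) /\
    (forall k x, le_order k.+1 p -> frechet_step D k x) /\
    (forall k x, le_order k p -> op_continuous D k x).

Definition supp (b : X -> R) : set X := closure [set x | b x != 0].

Definition is_bump (b : X -> R) : Prop :=
  (exists x, b x != 0) /\ exists M : R, forall x, supp b x -> `|x| <= M.

Definition lipschitz_fun (f : X -> R) : Prop :=
  exists L : R, forall x y, `|f x - f y| <= L * `|x - y|.

End Defs.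

Definition infinite_dimensional {R : realType} (X : normedModType R) : Prop :=
  forall n : nat, exists v : 'I_n -> X, forall c : 'I_n -> R,
    \sum_(i < n) c i *: v i = 0 -> forall i, c i = 0.

(* Main.v *)
Require Import Defs.
From HB Require Import structures.
From mathcomp Require Import all_boot all_order all_algebra.
From mathcomp Require Import all_classical all_reals all_analysis.
From mathcomp Require Import ring lra zify.
Set Implicit Arguments. Unset Strict Implicit. Unset Printing Implicit Defensive.
Import Order.TTheory GRing.Theory Num.Theory.
Import numFieldNormedType.Exports.
Local Open Scope classical_set_scope.
Local Open Scope ring_scope.

(* Let [b] be a bump with [0 <= b < 1] supported in a ball.  Split off a plane
   with coordinates [xi1, xi2] from [X], and let [phi] be the multivalued polar
   angle of the planar part.  Move the complementary part [zpart x] along a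
   bounded smooth curve [drift phi], whose values at parameters at distance at
   least 2 are far apart; such a curve exists because the dimension is infinite.
   Then for every [x] at most one determination of the angle makes
     [b (zpart x + kappa (xi1^2 + xi2^2 - 1) u1 - drift phi) - level phi]
   positive, and composing this expression with [exp (-1/u)] gives a function
   supported in an infinite coil, which is locally smooth because no two windings
   of the coil come close to each other.  Following the coil leaves the argument of
   [b] unchanged while [level phi] strictly decreases, so the derivative in this
   direction is positive inside the coil; the same computation shows that the
   boundary of the coil is not in the interior of the support.  The angle is
   Lipschitz near the unit circle, so the function is Lipschitz when [b] is. *)

(** * Higher differentiability of families of functions *)

(** A bump on a finite-dimensional space attains its maximum and has a critical point there, so
    infinite dimension has to enter. Here [level] decreases along the coil towards a positive limit
    that it never reaches, and the values along the coil increase for ever; this takes infinitely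
    many windings in a bounded set, at a uniform distance from each other. The argument of [bump]
    sees the plane only through its radius, placed on the [u1] axis: the other planar coordinate,
    the angle, is the direction of the coil and is spent on monotonicity. As [bump] stays below 1,
    the coil has a beginning, at a positive angle. The drift is a sum of translates of one scalar
    bump, multiplied by unit vectors that pair triangularly with forms of norm at most 1. At bounded
    angles only finitely many terms count, so each inner map of a composition is a linear map plus a
    finite sum of scalar functions times fixed vectors; this is the form in which the chain rule of
    order [k] is proved. *)

Section Families.
Context {R : realType} {X : normedModType R}.

(* A family [F : X -> V -> R] stands for a map from [X] to the functions on [V]
   that are bounded by a multiple of the weight [N]; its derivative is again such
   a family, indexed by [V * X].  This replaces spaces of multilinear forms. *)
Definition bdd_family (V : Type) (N G : V -> R) : Prop :=
  (forall v, 0 <= N v) /\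
  exists2 C, 0 <= C & forall v, `|G v| <= C * N v.

Definition cont_family (V : Type) (N : V -> R) (F : X -> V -> R) (x : X) :=
  forall e : R, 0 < e ->
    \forall y \near x, forall v, `|F y v - F x v| <= e * N v.

Definition dweight (V : Type) (N : V -> R) (vh : V * X) : R :=
  N vh.1 * `|vh.2|.

(** [v] is a mere index: linearity is asked in the increment only, and the error is uniform in [v]
    relative to [N v]. When [N v] is a product of norms, this is differentiability in the operator
    norm. *)
Definition fder (V : Type) (N : V -> R) (F : X -> V -> R) (x : X)
    (L : V * X -> R) : Prop :=
  [/\ forall v a h k, L (v, a *: h + k) = a * L (v, h) + L (v, k),
      bdd_family (dweight N) L
    & forall e : R, 0 < e -> \forall y \near x, forall v,
        `|F y v - F x v - L (v, y - x)| <= e * (N v * `|y - x|)].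

(** The index type gains a factor [X] with each derivative. Derivatives exist near [x], but bound
    and continuity of the highest one are asked at [x] alone, which makes the predicate pointwise
    and local. *)
Fixpoint Ck_family (k : nat) (V : Type) (N : V -> R) (F : X -> V -> R) (x : X) :=
  [/\ bdd_family N (F x), cont_family N F x
    & if k is k'.+1 then
        exists2 F' : X -> V * X -> R,
          (\forall y \near x, fder N F y (F' y)) & Ck_family k' (dweight N) F' x
      else True].

Lemma Ck_family_bdd k V (N : V -> R) F x : Ck_family k N F x -> bdd_family N (F x).
Proof. by case: k => [|k] []. Qed.

Lemma Ck_family_cont k V (N : V -> R) F x : Ck_family k N F x -> cont_family N F x.
Proof. by case: k => [|k] []. Qed.

Lemma Ck_family_pred k V (N : V -> R) F x : Ck_family k.+1 N F x -> Ck_family k N F x.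
Proof.
elim: k V N F => [|k IH] V N F /= [bF cF [F' dF CF]]; split=> //.
by exists F' => //; exact: IH.
Qed.

Lemma dweight_ge0 V (N : V -> R) :
  (forall v, 0 <= N v) -> forall vh, 0 <= dweight N vh.
Proof. by move=> N0 vh; rewrite /dweight mulr_ge0. Qed.

Lemma near_le1 (x : X) (e : R) : 0 < e -> \forall y \near x, `|y - x| <= e.
Proof.
move=> e0; apply/nbhs_normP; exists e => //= y /=.
by rewrite distrC => /ltW.
Qed.

Lemma fder_lip V (N : V -> R) F x L : (forall v, 0 <= N v) -> fder N F x L ->
  exists2 C, 0 <= C &
  \forall y \near x, forall v, `|F y v - F x v| <= C * (N v * `|y - x|).
Proof.
move=> N0 [_ [_ [C C0 bL]] /(_ _ ltr01) dF]; exists (C + 1); first exact: addr_ge0.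
near=> y => v.
have -> : F y v - F x v = L (v, y - x) + (F y v - F x v - L (v, y - x)) by ring.
have h1 : `|L (v, y - x)| <= C * (N v * `|y - x|) by exact: (bL (v, y - x)).
have h2 : `|F y v - F x v - L (v, y - x)| <= 1 * (N v * `|y - x|).
  by move: v {h1}; near: y; exact: dF.
by rewrite (le_trans (ler_normD _ _))// mulrDl; exact: lerD.
Unshelve. all: by end_near. Qed.

Lemma fder_cont V (N : V -> R) F x L :
  (forall v, 0 <= N v) -> fder N F x L -> cont_family N F x.
Proof.
move=> N0 /(fder_lip N0)[C C0 lF] e e0.
have d0 : 0 < e / (C + 1) by rewrite divr_gt0// ltr_wpDl.
near=> y => v.
have : `|F y v - F x v| <= C * (N v * `|y - x|) by move: v; near: y; exact: lF.
move/le_trans; apply; rewrite mulrCA mulrC ler_wpM2r//.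
have yx : `|y - x| <= e / (C + 1) by near: y; exact: near_le1.
rewrite (@le_trans _ _ ((C + 1) * (e / (C + 1))))//.
  by apply: ler_pM => //; rewrite lerDl.
by rewrite mulrC divfK// gt_eqF// ltr_wpDl.
Unshelve. all: by end_near. Qed.

Lemma Ck_familyS k V (N : V -> R) F F' x : bdd_family N (F x) ->
  (\forall y \near x, fder N F y (F' y)) -> Ck_family k (dweight N) F' x ->
  Ck_family k.+1 N F x.
Proof.
move=> bF dF CF; split=> //; last by exists F'.
exact: (fder_cont bF.1 (nbhs_singleton dF)).
Qed.

Lemma Ck_family_near k V (N : V -> R) F G x :
  (\forall y \near x, F y = G y) -> Ck_family k N F x -> Ck_family k N G x.
Proof.
move=> FG; have FGx := nbhs_singleton FG.
have cFG : cont_family N F x -> cont_family N G x.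
  move=> cF e e0; near=> y => v; rewrite -FGx -(near FG y) //.
  by move: v; near: y; exact: cF.
case: k => [|k] /= [bF cF dF]; rewrite -FGx; split=> //; try exact: cFG.
case: dF => F' dF CF; exists F' => //.
have FG2 : \forall y \near x, \forall z \near y, F z = G z by exact: near_join.
near=> y.
have [lin b est] : fder N F y (F' y) by near: y.
split=> // e e0; have FGy : \forall z \near y, F z = G z by near: y.
near=> z => v; rewrite -(near FGy z)// -(nbhs_singleton FGy).
by move: v; near: z; exact: est.
Unshelve. all: by end_near. Qed.

(** Each differentiation and each product creates a new index type; this lemma brings them all back
    to the wanted one, at the price of a constant in the weights. *)
Lemma Ck_family_reindex k V W (N : V -> R) (M : W -> R) (p : W -> V) C F x :
  0 <= C -> (forall w, 0 <= M w) -> (forall w, N (p w) <= C * M w) ->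
  Ck_family k N F x -> Ck_family k M (fun y w => F y (p w)) x.
Proof.
elim: k V W N M p F => [|k IH] V W N M p F C0 M0 NM.
all: have bMN D w : 0 <= D -> D * N (p w) <= (D * C) * M w
  by move=> D0; rewrite -mulrA ler_wpM2l.
(* [C] may be 0, hence the division by [C + 1]. *)
all: have dC (D : R) : 0 < D -> 0 < D / (C + 1)
  by move=> D0; rewrite divr_gt0// ltr_wpDl.
all: have bdC (D : R) w : 0 < D -> D / (C + 1) * N (p w) <= D * M w
  by move=> D0; apply: le_trans (bMN _ _ (ltW (dC _ D0))) _; apply: ler_wpM2r => //;
     rewrite mulrAC ler_pdivrMr ?ltr_wpDl//; apply: ler_wpM2l; [exact: ltW|rewrite lerDl].
all: move=> [[N0 [D D0 bF]] cF dF].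
all: have bF' : bdd_family M (fun w => F x (p w))
  by split=> //; exists (D * C); [exact: mulr_ge0|move=> w; exact: le_trans (bF _) (bMN _ _ D0)].
  split=> // e e0; near=> y => w; apply: le_trans (bdC _ w e0).
  by move: (p w); near: y; exact: cF (dC _ e0).
case: dF => F' dF CF.
apply: (@Ck_familyS _ _ _ _ (fun y wh => F' y (p wh.1, wh.2))) => //; last first.
  apply: (@IH _ _ _ _ (fun wh : W * X => (p wh.1, wh.2))) CF => //.
    by move=> wh; exact: dweight_ge0.
  by move=> w; rewrite /dweight/= mulrA ler_wpM2r.
apply: filterS dF => y [lin [_ [E E0 bF'y]] est]; split => //=.
  split; first exact: dweight_ge0.
  exists (E * C); first exact: mulr_ge0.
  move=> [w h] /=; apply: le_trans (bF'y _) _; rewrite /dweight /= !mulrA.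
  by rewrite ler_wpM2r// bMN.
move=> e e0; near=> z => w; rewrite mulrA.
apply: le_trans (ler_wpM2r (normr_ge0 _) (bdC _ w e0)); rewrite -(mulrA _ (N _)) /=.
by move: (p w); near: z; exact: est (dC _ e0).
Unshelve. all: by end_near. Qed.

Lemma Ck_family_add k V (N : V -> R) F G x :
  Ck_family k N F x -> Ck_family k N G x -> Ck_family k N (fun y v => F y v + G y v) x.
Proof.
elim: k V N F G => [|k IH] V N F G [[N0 [C C0 bF]] cF dF] [[_ [D D0 bG]] cG dG].
all: have b : bdd_family N (fun v => F x v + G x v)
  by split=> //; exists (C + D); [exact: addr_ge0|move=> v; rewrite mulrDl (le_trans (ler_normD _ _))// lerD].
  split=> // e e0; have e2 : 0 < e / 2 by rewrite divr_gt0.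
  near=> y => v.
  have -> : F y v + G y v - (F x v + G x v) = (F y v - F x v) + (G y v - G x v) by ring.
  rewrite (le_trans (ler_normD _ _))// (splitr e) mulrDl lerD//.
    by move: v; near: y; exact: cF.
  by move: v; near: y; exact: cG.
case: dF dG => F' dF CF [G' dG CG].
apply: (@Ck_familyS _ _ _ _ (fun y v => F' y v + G' y v)) => //; last exact: IH.
near=> y.
have [linF [_ [CF0 CF1 bFy]] estF] : fder N F y (F' y) by near: y.
have [linG [_ [CG0 CG1 bGy]] estG] : fder N G y (G' y) by near: y.
split.
- by move=> v a h l; rewrite linF linG; ring.
- split; first exact: dweight_ge0.
  exists (CF0 + CG0); [exact: addr_ge0|move=> v].
  by rewrite mulrDl (le_trans (ler_normD _ _))// lerD.
move=> e e0; have e2 : 0 < e / 2 by rewrite divr_gt0.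
near=> z => v.
have -> : F z v + G z v - (F y v + G y v) - (F' y (v, z - y) + G' y (v, z - y)) =
  (F z v - F y v - F' y (v, z - y)) + (G z v - G y v - G' y (v, z - y)) by ring.
rewrite (le_trans (ler_normD _ _))// (splitr e) mulrDl lerD//.
  by move: v; near: z; exact: estF.
by move: v; near: z; exact: estG.
Unshelve. all: by end_near. Qed.

Lemma Ck_family_cst k V (N : V -> R) (G : V -> R) x :
  bdd_family N G -> Ck_family k N (fun=> G) x.
Proof.
elim: k V N G => [|k IH] V N G bG.
  split=> // e e0; near=> y => v; rewrite subrr normr0.
  by apply: mulr_ge0; [exact: ltW|exact: bG.1].
have b0 : bdd_family (dweight N) (fun=> 0).
  split; [exact: dweight_ge0 bG.1|exists 0 => // v; by rewrite mul0r normr0].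
apply: (@Ck_familyS _ _ _ _ (fun _ _ => 0)) => //; last exact: IH.
near=> y; split=> [v a h l||e e0] //; first by rewrite mulr0 addr0.
near=> z => v; rewrite subrr subr0 normr0.
by apply: mulr_ge0; [exact: ltW|apply: mulr_ge0 => //; exact: bG.1].
Unshelve. all: by end_near. Qed.

Definition prodw (V W : Type) (N : V -> R) (M : W -> R) (vw : V * W) : R :=
  N vw.1 * M vw.2.

Lemma prod_estimate (a b c d A B e N M : R) :
  0 <= A -> 0 <= B -> 0 <= e -> 0 <= N -> 0 <= M ->
  `|a| <= A * N -> `|c - a| <= e * N -> `|b| <= B * M -> `|d - b| <= e * M ->
  `|c * d - a * b| <= (e * (A + B + e)) * (N * M).
Proof.
move=> A0 B0 e0 N0 M0 ha hc hb hd.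
have -> : c * d - a * b = (c - a) * b + a * (d - b) + (c - a) * (d - b) by ring.
have h1 : `|(c - a) * b| <= (e * N) * (B * M) by rewrite normrM ler_pM.
have h2 : `|a * (d - b)| <= (A * N) * (e * M) by rewrite normrM ler_pM.
have h3 : `|(c - a) * (d - b)| <= (e * N) * (e * M) by rewrite normrM ler_pM.
have := ler_normD ((c - a) * b + a * (d - b)) ((c - a) * (d - b)).
have := ler_normD ((c - a) * b) (a * (d - b)).
lra.
Qed.

(** The factors keep separate indices, so the two terms of the Leibniz rule are again products of
    this kind up to the place of the increment in the index, and the induction closes. *)
Lemma Ck_family_mul k V W (N : V -> R) (M : W -> R) F G x :
  Ck_family k N F x -> Ck_family k M G x ->
  Ck_family k (prodw N M) (fun y vw => F y vw.1 * G y vw.2) x.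
Proof.
elim: k V W N M F G => [|k IH] V W N M F G CF CG.
all: move: (CF) (CG) => [[N0 [A A0 bF]] cF dF] [[M0 [B B0 bG]] cG dG].
all: have NM0 vw : 0 <= prodw N M vw by rewrite mulr_ge0.
all: have b : bdd_family (prodw N M) (fun vw => F x vw.1 * G x vw.2)
  by split=> //; exists (A * B); [exact: mulr_ge0|move=> v; rewrite normrM mulrACA ler_pM].
  split=> // e e0.
  (* [prod_estimate] yields a term in [d * d], which [d <= 1] absorbs. *)
  pose d := Num.min 1 (e / (A + B + 1)).
  have AB : 0 < A + B + 1 by rewrite ltr_wpDl// addr_ge0.
  have d0 : 0 < d by rewrite lt_min ltr01 divr_gt0.
  have de : d * (A + B + d) <= e.
    have d1 : d <= 1 by rewrite ge_min lexx.
    have : d <= e / (A + B + 1) by rewrite ge_min lexx orbT.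
    rewrite ler_pdivlMr// => /(le_trans _); apply; apply: ler_wpM2l; first exact: ltW.
    by rewrite lerD2l.
  near=> y.
  have hF : forall v, `|F y v - F x v| <= d * N v by near: y; exact: cF.
  have hG : forall w, `|G y w - G x w| <= d * M w by near: y; exact: cG.
  move=> [v w] /=; apply: le_trans (ler_wpM2r (NM0 (v, w)) de).
  by apply: prod_estimate => //; exact: ltW.
case: dF dG => F' dF CF' [G' dG CG'].
apply: (@Ck_familyS _ _ _ _ (fun y vwh => F' y (vwh.1.1, vwh.2) * G y vwh.1.2
     + F y vwh.1.1 * G' y (vwh.1.2, vwh.2))) => //; last first.
  have dNM0 : forall w : V * W * X, 0 <= dweight (prodw N M) w by exact: dweight_ge0.
  apply: Ck_family_add.
    have := IH _ _ _ _ _ _ CF' (Ck_family_pred CG).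
    move=> /(@Ck_family_reindex k _ (V * W * X)%type _ (dweight (prodw N M))
      (fun p => ((p.1.1, p.2), p.1.2)) 1); apply => // -[[v w] h].
    by rewrite /prodw /dweight /= mul1r mulrAC.
  have := IH _ _ _ _ _ _ (Ck_family_pred CF) CG'.
  move=> /(@Ck_family_reindex k _ (V * W * X)%type _ (dweight (prodw N M))
    (fun p => (p.1.1, (p.1.2, p.2))) 1); apply => // -[[v w] h].
  by rewrite /prodw /dweight /= mul1r mulrA.
near=> y.
have [linF [_ [CF0 CF1 bFy]] estF] : fder N F y (F' y) by near: y.
have [linG [_ [CG0 CG1 bGy]] estG] : fder M G y (G' y) by near: y.
have [A' A0' bFA] : exists2 A', 0 <= A' & forall v, `|F y v| <= A' * N v.
  exists (A + 1); first exact: addr_ge0.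
  move=> v; have -> : F y v = F x v + (F y v - F x v) by ring.
  rewrite (le_trans (ler_normD _ _))// mulrDl lerD//.
  by move: v; near: y; exact: cF.
have [B' B0' bGB] : exists2 B', 0 <= B' & forall v, `|G y v| <= B' * M v.
  exists (B + 1); first exact: addr_ge0.
  move=> v; have -> : G y v = G x v + (G y v - G x v) by ring.
  rewrite (le_trans (ler_normD _ _))// mulrDl lerD//.
  by move: v; near: y; exact: cG.
split.
- by move=> [v w] a h l /=; rewrite linF linG; ring.
- split; first exact: dweight_ge0.
  exists (CF0 * B' + A' * CG0); first by rewrite addr_ge0 ?mulr_ge0.
  move=> [[v w] h] /=; rewrite (le_trans (ler_normD _ _))// mulrDl /dweight /prodw /=.
  rewrite lerD// normrM.
    by apply: le_trans (ler_pM _ _ (bFy _) (bGB w)) _ => //; rewrite /dweight/= le_eqVlt; apply/orP; left; apply/eqP; ring.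
  by apply: le_trans (ler_pM _ _ (bFA v) (bGy _)) _ => //; rewrite /dweight/= le_eqVlt; apply/orP; left; apply/eqP; ring.
move=> e e0.
have [C C0 lF] := fder_lip N0 (And3 linF (conj (dweight_ge0 N0) (ex_intro2 _ _ CF0 CF1 bFy)) estF).
have cGy := fder_cont M0 (And3 linG (conj (dweight_ge0 M0) (ex_intro2 _ _ CG0 CG1 bGy)) estG).
(* Three errors add up: remainder of [F] times [G], [F] times remainder of [G], and the product of
   both increments, with factors [B'], [A'] and [C]. *)
pose d := e / (A' + B' + C + 1).
have S0 : 0 < A' + B' + C + 1 by rewrite ltr_wpDl// !addr_ge0.
have d0 : 0 < d by rewrite divr_gt0.
have de : d * (A' + B' + C) <= e.
  rewrite /d mulrAC ler_pdivrMr// ler_wpM2l ?ltW// ; lra.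
near=> z.
have H1 : forall v, `|F z v - F y v - F' y (v, z - y)| <= d * (N v * `|z - y|)
  by near: z; exact: estF.
have H2 : forall w, `|G z w - G y w - G' y (w, z - y)| <= d * (M w * `|z - y|)
  by near: z; exact: estG.
have H3 : forall v, `|F z v - F y v| <= C * (N v * `|z - y|)
  by near: z; exact: lF.
have H4 : forall w, `|G z w - G y w| <= d * M w by near: z; exact: cGy.
move=> [v w] /=; move: (H1 v) (H2 w) (H3 v) (H4 w) => h1 h2 h3 h4.
rewrite /prodw /=.
set p := F z v; set q := G z w.
have -> : p * q - F y v * G y w - (F' y (v, z - y) * G y w + F y v * G' y (w, z - y))
  = (p - F y v - F' y (v, z - y)) * G y w + F y v * (q - G y w - G' y (w, z - y))
    + (p - F y v) * (q - G y w) by ring.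
have k1 := ler_pM (normr_ge0 _) (normr_ge0 _) h1 (bGB w).
have k2 := ler_pM (normr_ge0 _) (normr_ge0 _) (bFA v) h2.
have k3 := ler_pM (normr_ge0 _) (normr_ge0 _) h3 h4.
have kk : (d * (A' + B' + C)) * (N v * M w * `|z - y|) <= e * (N v * M w * `|z - y|).
  by apply: ler_wpM2r => //; rewrite !mulr_ge0.
apply: le_trans (ler_normD _ _) _; apply: le_trans (lerD (ler_normD _ _) (lexx _)) _.
rewrite !normrM; apply: le_trans (lerD (lerD k1 k2) k3) _; lra.
Unshelve. all: by end_near. Qed.

End Families.

(** * Chain rule *)

Section Composition.
Context {R : realType} {X Y : normedModType R}.

Definition vder (Phi : X -> Y) (x : X) (D : X -> Y) : Prop :=
  [/\ forall a h k, D (a *: h + k) = a *: D h + D k,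
      exists2 C, 0 <= C & forall h, `|D h| <= C * `|h|
    & forall e : R, 0 < e -> \forall y \near x,
        `|Phi y - Phi x - D (y - x)| <= e * `|y - x|].

Lemma vder_lip Phi x D : vder Phi x D ->
  exists2 C, 0 <= C & \forall y \near x, `|Phi y - Phi x| <= C * `|y - x|.
Proof.
move=> [_ [C C0 bD] /(_ _ ltr01) dPhi]; exists (C + 1); first exact: addr_ge0.
apply: filterS dPhi => y dy.
rewrite -(subrK (D (y - x)) (Phi y - Phi x)) mulrDl addrC.
by rewrite (le_trans (ler_normD _ _))// lerD.
Qed.

Lemma lip_cvg (Phi : X -> Y) x C : 0 <= C ->
  (\forall y \near x, `|Phi y - Phi x| <= C * `|y - x|) ->
  Phi y @[y --> x] --> Phi x.
Proof.
move=> C0 lPhi; apply/cvgrPdist_le => e e0.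
have d0 : 0 < e / (C + 1) by rewrite divr_gt0// ltr_wpDl.
near=> y; rewrite distrC.
have : `|Phi y - Phi x| <= C * `|y - x| by near: y.
move/le_trans; apply.
have yx : `|y - x| <= e / (C + 1) by near: y; exact: near_le1.
rewrite (@le_trans _ _ ((C + 1) * (e / (C + 1))))//.
  by apply: ler_pM => //; rewrite lerDl.
by rewrite mulrC divfK// gt_eqF// ltr_wpDl.
Unshelve. all: by end_near. Qed.

Lemma fder_comp (V : Type) (N : V -> R) (G : Y -> V -> R) Phi x L D :
  (forall v, 0 <= N v) ->
  fder N G (Phi x) L -> vder Phi x D ->
  fder N (fun y => G (Phi y)) x (fun vh => L (vh.1, D vh.2)).
Proof.
move=> N0 [linL [_ [E E0 bL]] dG] vD.
have [C C0 lPhi] := vder_lip vD.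
case: vD => [linD [B B0 bD] dPhi].
split => /=.
- by move=> v a h k; rewrite linD linL.
- split; first exact: dweight_ge0.
  exists (E * B); first exact: mulr_ge0.
  move=> [v h] /=; apply: le_trans (bL _) _; rewrite /dweight /=.
  by rewrite -mulrA ler_wpM2l// mulrCA ler_wpM2l.
move=> e e0; pose d := e / (C + E + 1).
have S0 : 0 < C + E + 1 by rewrite ltr_wpDl// addr_ge0.
have d0 : 0 < d by rewrite divr_gt0.
have de : d * (C + E) <= e.
  by rewrite /d mulrAC ler_pdivrMr// (ler_wpM2l (ltW e0))// lerDl.
have dG' : \forall y \near x, forall v,
    `|G (Phi y) v - G (Phi x) v - L (v, Phi y - Phi x)| <= d * (N v * `|Phi y - Phi x|).
  exact: (lip_cvg C0 lPhi) (dG _ d0).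
near=> y.
have H1 : forall v, `|G (Phi y) v - G (Phi x) v - L (v, Phi y - Phi x)| <=
  d * (N v * `|Phi y - Phi x|) by near: y.
have H2 : `|Phi y - Phi x| <= C * `|y - x| by near: y.
have H3 : `|Phi y - Phi x - D (y - x)| <= d * `|y - x| by near: y; exact: dPhi.
move=> v.
have -> : G (Phi y) v - G (Phi x) v - L (v, D (y - x)) =
  (G (Phi y) v - G (Phi x) v - L (v, Phi y - Phi x)) +
  L (v, Phi y - Phi x - D (y - x)).
  have -> : Phi y - Phi x - D (y - x) = (-1) *: D (y - x) + (Phi y - Phi x)
    by rewrite scaleN1r addrC.
  by rewrite linL; ring.
have h1 : d * (N v * `|Phi y - Phi x|) <= d * (N v * (C * `|y - x|)).
  by apply: ler_wpM2l; [exact: ltW|exact: ler_wpM2l].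
have h2 : E * (N v * `|Phi y - Phi x - D (y - x)|) <= E * (N v * (d * `|y - x|)).
  by apply: ler_wpM2l => //; exact: ler_wpM2l.
have h3 : d * (C + E) * (N v * `|y - x|) <= e * (N v * `|y - x|).
  by rewrite ler_wpM2r// mulr_ge0.
have := ler_normD (G (Phi y) v - G (Phi x) v - L (v, Phi y - Phi x))
  (L (v, Phi y - Phi x - D (y - x))).
have := bL (v, Phi y - Phi x - D (y - x)); rewrite /dweight /=.
have := H1 v; lra.
Unshelve. all: by end_near. Qed.

End Composition.

Section Scalar.
Context {R : realType} {X : normedModType R}.

Definition w1 (_ : unit) : R := 1.

Definition Ck (k : nat) (f : X -> R) (x : X) := Ck_family k w1 (fun y _ => f y) x.

Lemma w1_ge0 : forall v, 0 <= w1 v. Proof. by rewrite /w1. Qed.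

Lemma bdd_w1 (f : unit -> R) : bdd_family w1 f.
Proof. by split; [exact: w1_ge0|exists `|f tt| => // -[]; rewrite /w1 mulr1]. Qed.

Lemma Ck_cvg k f x : Ck k f x -> f y @[y --> x] --> f x.
Proof.
move=> /Ck_family_cont cf; apply/cvgrPdist_le => e e0.
by apply: filterS (cf _ e0) => y /(_ tt); rewrite /w1 mulr1 distrC.
Qed.

Lemma Ck_family_sum n k V (N : V -> R) (F : 'I_n -> X -> V -> R) x :
  (forall v, 0 <= N v) -> (forall i, Ck_family k N (F i) x) ->
  Ck_family k N (fun y v => \sum_i F i y v) x.
Proof.
move=> N0; elim: n F => [|n IH] F CF.
  apply: (@Ck_family_near _ _ _ _ _ (fun _ _ => 0)).
    by apply: nearW => y; apply/funext => v; rewrite big_ord0.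
  by apply: Ck_family_cst; split=> //; exists 0 => // v; rewrite mul0r normr0.
apply: (@Ck_family_near _ _ _ _ _
   (fun y v => F ord0 y v + \sum_i F (lift ord0 i) y v)).
  by apply: nearW => y; apply/funext => v; rewrite big_ord_recl.
by apply: Ck_family_add => //; exact: IH.
Qed.

End Scalar.

Lemma subr_rearrange (V : zmodType) (a b c d e : V) :
  a + b - (c + d) - (a - c + e) = b - d - e.
Proof.
have -> : a + b - (c + d) = (a - c) + (b - d) by rewrite opprD addrACA.
by rewrite opprD addrACA subrr add0r.
Qed.

Section CompositionCk.
Context {R : realType} {X Y : normedModType R}.

(** With an inner map of this shape, smoothness of vector-valued maps reduces to that of the scalar
    coefficients [g i]: the derivative of the inner map is again linear plus scalar functions times
    the fixed vectors [u i]. *)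
Lemma Ck_family_comp k n V (N : V -> R) (G : Y -> V -> R) (A : X -> Y)
    (g : 'I_n -> X -> R) (u : 'I_n -> Y) x (C : R) :
  (forall a h l, A (a *: h + l) = a *: A h + A l) -> 0 <= C ->
  (forall h, `|A h| <= C * `|h|) ->
  (forall i, Ck k (g i) x) ->
  Ck_family k N G (A x + \sum_i g i x *: u i) ->
  Ck_family k N (fun y => G (A y + \sum_i g i y *: u i)) x.
Proof.
move=> linA C0 bA.
have AB z y : A (z - y) = A z - A y.
  by have := linA (-1) y z; rewrite !scaleN1r ![- _ + _]addrC.
have cvgPhi j y : (forall i, Ck j (g i) y) ->
    A z + \sum_i g i z *: u i @[z --> y] --> A y + \sum_i g i y *: u i.
  move=> Cg; apply: cvgD.
    apply: (lip_cvg C0); apply: nearW => z.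
    by rewrite -AB.
  apply: cvg_big => [|i _]; first exact: add_continuous.
  by apply: cvgZr_tmp; exact: Ck_cvg (Cg i).
elim: k V N G => [|k IH] V N G Cg CG.
  case: CG => bG cG _; split=> // e e0.
  exact: (cvgPhi _ _ Cg) (cG _ e0).
case: (CG) => [[N0 bG] cG [G' dG CG']].
pose Phi y := A y + \sum_i g i y *: u i.
have [g' dg Cg'] : exists2 g' : 'I_n -> X -> unit * X -> R,
  (\forall y \near x, forall i, fder w1 (fun y _ => g i y) y (g' i y)) &
  (forall i, Ck_family k (dweight w1) (g' i) x).
  have /choice[g' H] : forall i, exists g', (\forall y \near x, fder w1 (fun y _ => g i y) y (g' y)) /\ Ck_family k (dweight w1) g' x.
    by move=> i; case: (Cg i) => _ _ [g' ? ?]; exists g'.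
  exists g'; last by move=> i; case: (H i).
  by apply: filter_forall => i; case: (H i).
have vPhi : \forall y \near x, vder Phi y (fun h => A h + \sum_i g' i y (tt, h) *: u i).
  apply: filterS dg => y dg; split.
  - move=> a h l; rewrite linA scalerDr addrACA scaler_sumr -big_split/=.
    congr (_ + _); apply: eq_bigr => i _.
    by have [-> _ _] := dg i; rewrite scalerDl scalerA.
  - have /choice[E bE] : forall i, exists E, 0 <= E /\ forall h, `|g' i y (tt, h)| <= E * `|h|.
      move=> i; have [_ [_ [E E0 bE]] _] := dg i; exists E; split=> // h.
      by have := bE (tt, h); rewrite /dweight/= /w1 mul1r.
    exists (C + \sum_i E i * `|u i|).
      rewrite addr_ge0// sumr_ge0// => i _; rewrite mulr_ge0//; by case: (bE i).
    move=> h; rewrite mulrDl (le_trans (ler_normD _ _))// lerD//.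
    rewrite mulr_suml (le_trans (ler_norm_sum _ _ _))// ler_sum// => i _.
    by rewrite normrZ mulrAC ler_wpM2r//; case: (bE i).
  move=> e e0; pose S := \sum_i `|u i| + 1.
  have S0 : 0 < S by rewrite /S ltr_wpDl// sumr_ge0.
  have d0 : 0 < e / S by rewrite divr_gt0.
  have dg2 : \forall z \near y, forall i, `|g i z - g i y - g' i y (tt, z - y)| <= e / S * `|z - y|.
    apply: filter_forall => i; have [_ _ /(_ _ d0)] := dg i.
    by apply: filterS => z /(_ tt); rewrite /w1 mul1r.
  apply: filterS dg2 => z dg2.
  have -> : Phi z - Phi y - (A (z - y) + \sum_i g' i y (tt, z - y) *: u i) =
    \sum_i (g i z - g i y - g' i y (tt, z - y)) *: u i.
    under [RHS]eq_bigr do rewrite !scalerBl.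
    rewrite !sumrB /Phi AB; exact: subr_rearrange.
  rewrite (le_trans (ler_norm_sum _ _ _))//.
  have -> : e * `|z - y| = e / S * `|z - y| * S by rewrite mulrAC divfK// gt_eqF.
  rewrite /S mulrDr mulr_sumr; apply: ler_wpDr; first by rewrite mulr1 mulr_ge0// ltW.
  by apply: ler_sum => i _; rewrite normrZ ler_wpM2r.
have dGP : \forall y \near x, fder N G (Phi y) (G' (Phi y)).
  exact: (cvgPhi _ _ Cg) dG.
apply: (@Ck_familyS _ _ _ _ _ _ (fun y vh => G' (Phi y) (vh.1, A vh.2 + \sum_i g' i y (tt, vh.2) *: u i))).
- by split.
- near=> y.
  have H1 : fder N G (Phi y) (G' (Phi y)) by near: y.
  have H2 : vder Phi y (fun h => A h + \sum_i g' i y (tt, h) *: u i) by near: y.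
  exact: (fder_comp N0 H1 H2).
(* Expanding by linearity in the increment leaves only reindexed copies of [G' (Phi y)] and their
   products with scalar derivatives, which the induction hypothesis and the product lemma cover. *)
apply: (@Ck_family_near _ _ _ _ _ (fun y vh => G' (Phi y) (vh.1, A vh.2)
    + \sum_i g' i y (tt, vh.2) * G' (Phi y) (vh.1, u i))).
  apply: filterS dGP => y [linG _ _]; apply/funext => -[v h] /=.
  have Z w : G' (Phi y) (v, w) = G' (Phi y) (v, 1 *: w) by rewrite scale1r.
  have G0 : G' (Phi y) (v, 0) = 0.
    by have := linG v 1 0 0; rewrite scale1r addr0 mul1r => /eqP; rewrite -subr_eq0 opprD addrA subrr sub0r oppr_eq0 => /eqP.
  have GD w1 w2 : G' (Phi y) (v, w1 + w2) = G' (Phi y) (v, w1) + G' (Phi y) (v, w2).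
    by rewrite -{1}[w1]scale1r linG mul1r.
  rewrite GD; congr (_ + _).
  rewrite (big_morph (fun w => G' (Phi y) (v, w)) GD G0); apply: eq_bigr => i _.
  by rewrite -[_ *: _]addr0 linG G0 addr0.
have Cgk i : Ck k (g i) x by exact: (Ck_family_pred (Cg i)).
have CGP : Ck_family k (dweight N) (fun y => G' (Phi y)) x by exact: IH.
have dN0 : forall vh : V * X, 0 <= dweight N vh by exact: dweight_ge0.
apply: Ck_family_add.
  move: CGP => /(@Ck_family_reindex _ _ _ _ (V * X)%type _ (dweight N)
    (fun vh => (vh.1, A vh.2)) C); apply=> //.
  by move=> vh; rewrite /dweight/= mulrCA ler_wpM2l.
apply: Ck_family_sum => [//|i].
have := Ck_family_mul (Cg' i) CGP.
move=> /(@Ck_family_reindex _ _ _ _ (V * X)%type _ (dweight N)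
   (fun vh => ((tt, vh.2), (vh.1, u i))) `|u i|); apply => //.
by move=> vh; rewrite /prodw /dweight /w1 /= mul1r le_eqVlt; apply/orP; left; apply/eqP; ring.
Unshelve. all: by end_near. Qed.

End CompositionCk.

(** * Calculus of scalar functions of class C^k *)

Section ScalarCalculus.
Context {R : realType} {X : normedModType R}.

Lemma Ck_cst k (c : R) (x : X) : Ck k (fun=> c) x.
Proof. by apply: Ck_family_cst; exact: bdd_w1. Qed.

Lemma Ck_near k (f g : X -> R) x :
  (\forall y \near x, f y = g y) -> Ck k f x -> Ck k g x.
Proof. by move=> fg; apply: Ck_family_near; apply: filterS fg => y ->. Qed.

Lemma Ck_add k (f g : X -> R) x :
  Ck k f x -> Ck k g x -> Ck k (fun y => f y + g y) x.
Proof. exact: Ck_family_add. Qed.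

Lemma Ck_mul k (f g : X -> R) x :
  Ck k f x -> Ck k g x -> Ck k (fun y => f y * g y) x.
Proof.
move=> Cf Cg; move: (Ck_family_mul Cf Cg) => /(@Ck_family_reindex _ _ _ _ unit _ w1
  (fun _ => (tt, tt)) 1); apply => // w; rewrite /prodw /w1 !mul1r //.
Qed.

Lemma Ck_opp k (f : X -> R) x : Ck k f x -> Ck k (fun y => - f y) x.
Proof.
move=> /(Ck_mul (Ck_cst k (-1) x)); apply: Ck_near.
by apply: nearW => y; rewrite mulN1r.
Qed.

Lemma Ck_sub k (f g : X -> R) x :
  Ck k f x -> Ck k g x -> Ck k (fun y => f y - g y) x.
Proof. by move=> Cf Cg; apply: Ck_add => //; exact: Ck_opp. Qed.

Lemma Ck_linear k (xi : X -> R) C x : 0 <= C ->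
  (forall a h l, xi (a *: h + l) = a * xi h + xi l) ->
  (forall h, `|xi h| <= C * `|h|) -> Ck k xi x.
Proof.
move=> C0 lin bxi.
suff H : Ck k.+1 xi x by exact: (Ck_family_pred H).
have b : bdd_family (dweight w1) (fun vh : unit * X => xi vh.2).
  split; first by apply: dweight_ge0; exact: w1_ge0.
  by exists C => // vh; rewrite /dweight /w1 mul1r.
apply: (@Ck_familyS _ _ _ _ _ _ (fun _ vh => xi vh.2)); first exact: bdd_w1.
  near=> y; split=> // e e0; near=> z => v /=.
  have -> : xi (z - y) = xi z - xi y.
    by have := lin (-1) y z; rewrite scaleN1r mulN1r ![- _ + _]addrC.
  by rewrite subrr normr0; apply: mulr_ge0; [exact: ltW|apply: mulr_ge0 => //; exact: w1_ge0].
exact: Ck_family_cst.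
Unshelve. all: by end_near. Qed.

Lemma Ck_comp k (g : R -> R) (f : X -> R) x :
  Ck k g (f x) -> Ck k f x -> Ck k (fun y => g (f y)) x.
Proof.
move=> Cg Cf.
have E y : 0 + \sum_(i < 1) f y *: (1 : R) = f y.
  by rewrite big_ord1 add0r /GRing.scale/= mulr1.
apply: (@Ck_family_near _ _ _ _ _ (fun y _ => g (0 + \sum_(i < 1) f y *: (1 : R)))).
  by apply: nearW => y; rewrite E.
apply: (@Ck_family_comp _ _ _ k 1 _ w1 (fun y _ => g y) (fun=> 0) (fun=> f) (fun=> 1) x 0) => //.
- by move=> a h l; rewrite scaler0 addr0.
- by move=> h; rewrite normr0 mul0r.
- by rewrite E.
Qed.

End ScalarCalculus.

Section OneVariable.
Context {R : realType}.

Lemma is_derive_fder (g : R -> R) (x d : R) :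
  is_derive x 1 g d -> fder w1 (fun y _ => g y) x (fun vh => d * vh.2).
Proof.
move=> [dg <-]; split.
- by move=> _ a h l /=; rewrite /GRing.scale/=; ring.
- split; first by apply: dweight_ge0; exact: w1_ge0.
  by exists `|'D_1 g x| => // vh; rewrite /dweight /w1 mul1r normrM.
move=> e e0.
have /cvgrPdist_le/(_ _ e0) : h^-1 *: (g (h + x) - g x) @[h --> 0^'] --> 'D_1 g x.
  by move: dg; rewrite /derivable /derive; under eq_fun do rewrite [_ *: 1]mulr1.
move=> /nbhs_ballP[r/= r0 H].
apply/nbhs_ballP; exists r => //= y; rewrite -ball_normE/= => xy [] /=.
rewrite /w1 mul1r; have [->|yx] := eqVneq y x.
  by rewrite !subrr mulr0 subrr normr0 mulr0.
have := H (y - x); rewrite -ball_normE/= sub0r normrN distrC => /(_ xy).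
rewrite subr_eq0 => /(_ yx); rewrite subrK => H'.
have yx0 : y - x != 0 by rewrite subr_eq0.
have -> : g y - g x - 'D_1 g x * (y - x) =
   - (('D_1 g x - (y - x)^-1 *: (g y - g x)) * (y - x)).
  by rewrite /GRing.scale/=; field.
by rewrite normrN normrM -(distrC y x) ler_wpM2r.
Qed.

Lemma Ck_derive k (g g1 : R -> R) (x : R) :
  (\forall y \near x, is_derive (y : R) (1 : R) g (g1 y)) -> Ck k g1 x -> Ck k.+1 g x.
Proof.
move=> dg Cg1; apply: (@Ck_familyS _ _ _ _ _ _ (fun y vh => g1 y * vh.2)).
- exact: bdd_w1.
- by apply: filterS dg => y; exact: is_derive_fder.
have b : bdd_family (fun h : R => `|h|) id by split=> //; exists 1 => // h; rewrite mul1r.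
move: (Ck_family_mul Cg1 (Ck_family_cst k x b)) => /(@Ck_family_reindex _ _ _ _ (unit * R)%type _ (dweight w1)
  (fun vh => (tt, vh.2)) 1); apply => //; last by move=> w; rewrite /prodw /dweight /w1 /= !mul1r.
by apply: dweight_ge0; exact: w1_ge0.
Qed.

Lemma Ck_0 (g : R -> R) (x : R) : {for x, continuous g} -> Ck 0 g x.
Proof.
move=> cg; split=> //; first exact: bdd_w1.
move=> e e0; move: cg => /cvgrPdist_le/(_ _ e0); apply: filterS => y H [].
by rewrite /w1 mulr1 distrC.
Qed.

Lemma Ck_id k (x : R) : Ck k id x.
Proof.
by apply: (@Ck_linear _ _ _ _ 1) => // h; rewrite mul1r.
Qed.

Lemma Ck_inv k (x : R) : x != 0 -> Ck k (fun y : R => y^-1) x.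
Proof.
elim: k x => [|k IH] x x0; first by apply: Ck_0; exact: inv_continuous.
apply: (@Ck_derive _ _ (fun y => - (y^-1 * y^-1))).
  have : \forall y \near x, y != 0 by apply: (@cvgr_neq0 _ _ _ (nbhs x) _ id x) => //; exact: cvg_id.
  apply: filterS => y y0; apply: is_derive_eq (is_deriveV y0 (is_derive_id y (1 : R))) _.
  by rewrite -invfM -expr2; exact: mulr1.
by apply: Ck_opp; apply: Ck_mul; exact: IH.
Qed.

Lemma Ck_atan k (x : R) : Ck k atan x.
Proof.
elim: k x => [|k IH] x; first by apply: Ck_0; exact: continuous_atan.
apply: (@Ck_derive _ _ (fun y => (1 + y * y)^-1)).
  by apply: filterE => y; rewrite -expr2; exact: is_derive1_atan.
apply: (@Ck_comp _ _ _ (fun y => y^-1) (fun y : R => 1 + y * y)).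
  by apply: Ck_inv; rewrite gt_eqF// ltr_wpDr// -expr2 sqr_ge0.
by apply: Ck_add; [exact: Ck_cst|apply: Ck_mul; exact: Ck_id].
Qed.

End OneVariable.

(** * The flat function exp(-1/u) *)

Section Flat.
Context {R : realType}.

Lemma is_derive_lip (g dg : R -> R) (M : R) :
  (forall x : R, is_derive x (1 : R) g (dg x)) -> (forall x, `|dg x| <= M) ->
  forall a b, `|g a - g b| <= M * `|a - b|.
Proof.
move=> dgP dgM a b; wlog ab : a b / b < a.
  move=> H; have [/H//|/H|->] := ltgtP b a; last by rewrite !subrr normr0 mulr0.
  by rewrite distrC (distrC a).
have [|c _ ->] := MVT ab (fun x _ => dgP x).
  apply: continuous_subspaceT => x; apply: differentiable_continuous.
  by apply/derivable1_diffP; exact: (@ex_derive _ _ _ _ _ _ _ (dgP x)).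
by rewrite normrM ler_wpM2r.
Qed.

(** Only [flat 0] is used as a cutoff. The factors [u^-1 ^+ n] make the family stable under
    differentiation, so that smoothness at all orders is one induction over all [n] at once. *)
Definition flat (n : nat) (u : R) : R :=
  if 0 < u then u^-1 ^+ n * expR (- u^-1) else 0.

Lemma expR_ge_pow n (y : R) : 0 <= y -> y ^+ n <= n`!%:R * expR y.
Proof.
move=> y0; case: n => [|n]; first by rewrite expr0 fact0 mul1r; have := expR_ge1Dx y; lra.
have := expR_ge1Dxn n y0; rewrite -lerBrDl ler_pdivrMr ?ltr0n ?fact_gt0//.
move/le_trans; apply; rewrite mulrC ler_wpM2l// lerBlDr lerDl//.
Qed.

Lemma pow_exp_le n (y : R) : 0 <= y -> y ^+ n * expR (- y) <= n`!%:R.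
Proof. by move=> /(expR_ge_pow n); rewrite expRN ler_pdivrMr ?expR_gt0. Qed.

Lemma flat_ge0 n u : 0 <= flat n u.
Proof.
rewrite /flat; case: ifPn => // u0.
by rewrite mulr_ge0 ?expR_ge0// exprn_ge0// invr_ge0 ltW.
Qed.

Lemma flat_gt0 n u : 0 < u -> 0 < flat n u.
Proof.
by move=> u0; rewrite /flat u0 mulr_gt0 ?expR_gt0// exprn_gt0// invr_gt0.
Qed.

Lemma flat_le0 n u : u <= 0 -> flat n u = 0.
Proof. by rewrite /flat ltNge => ->. Qed.

Lemma flat_le n u : flat n u <= n`!%:R.
Proof.
rewrite /flat; case: ifPn => // u0.
by apply: pow_exp_le; rewrite invr_ge0 ltW.
Qed.

(** A quadratic bound makes the difference quotient at 0 tend to 0, the only delicate point of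
    [is_derive_flat]. *)
Lemma flat_le_sq n u : flat n u <= (n.+2)`!%:R * u ^+ 2.
Proof.
rewrite /flat; case: ifPn => [u0|_]; last by rewrite mulr_ge0 ?sqr_ge0.
have i0 : 0 <= u^-1 by rewrite invr_ge0 ltW.
have := pow_exp_le n.+2 i0; rewrite -(ler_pM2r (exprn_gt0 2 u0)).
apply: le_trans; rewrite -addn2 exprD -mulrA [u^-1 ^+ 2 * _]mulrC -mulrA -mulrA.
by rewrite -exprMn mulVf ?gt_eqF// expr1n mulr1.
Qed.

Lemma is_derive_flat n (u : R) :
  is_derive u 1 (flat n) (flat n.+2 u - n%:R * flat n.+1 u).
Proof.
have [u0|u0|->] := ltgtP u 0.
- rewrite !flat_le0 ?ltW// mulr0 subr0.
  apply: (@near_eq_is_derive _ _ _ (fun=> 0) _ _ _ _ _ (is_derive_cst _ _ _)).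
  have : \forall v \near u, v < 0 by exact: lt_nbhsl.
  by apply: filterS => v v0; rewrite flat_le0// ltW.
- rewrite /flat u0.
  have dV : is_derive u 1 (fun v : R => v^-1) (- u ^- 2).
    apply: is_derive_eq (is_deriveV (lt0r_neq0 u0) (is_derive_id u (1 : R))) _.
    exact: mulr1.
  have dE : is_derive u 1 (fun v : R => expR (- v^-1)) (expR (- u^-1) * u ^- 2).
    apply: (@is_derive1_comp _ expR (fun v : R => - v^-1)).
    by apply: is_derive_eq (is_deriveN dV) _; rewrite opprK.
  have dM := is_deriveM (is_deriveX n dV) dE.
  apply: (@near_eq_is_derive _ _ _ _ _ _ _ _ _ (is_derive_eq dM _)).
    have : \forall v \near u, 0 < v by exact: lt_nbhsr.
    by apply: filterS => v v0; rewrite v0 !fctE.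
  rewrite /GRing.scale/=; case: n {dM} => [|n] /=.
    by rewrite !fctE expr0; field; rewrite gt_eqF.
  by rewrite !fctE !exprS; field; rewrite gt_eqF.
- rewrite !flat_le0// mulr0 subr0.
  pose C : R := (n.+2)`!%:R.
  have H : (fun h => h^-1 *: (flat n (h *: 1 + 0) - flat n 0)) @ 0^' --> (0 : R).
    apply/cvgrPdist_le => e e0; near=> h.
    rewrite sub0r normrN (flat_le0 n (lexx 0)) subr0 addr0 [h *: 1]mulr1.
    have h0 : h != 0 by near: h; exact: nbhs_dnbhs_neq.
    rewrite normrM normfV ler_pdivrMl ?normr_gt0//.
    rewrite (ger0_norm (flat_ge0 _ _)).
    apply: le_trans (flat_le_sq _ _) _; rewrite -/C -real_normK ?num_real//.
    rewrite expr2 mulrCA; apply: ler_wpM2l => //.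
    have : `|h| <= e / (C + 1).
      by near: h; apply: dnbhs0_le; rewrite divr_gt0// ltr_wpDl.
    rewrite ler_pdivlMr ?ltr_wpDl// mulrDr mulr1 mulrC; apply: le_trans.
    by rewrite lerDl.
  by split; [apply/cvg_ex; exists 0|exact: cvg_lim H].
Unshelve. all: by end_near. Qed.

Lemma Ck_flat k n (u : R) : Ck k (flat n) u.
Proof.
elim: k n u => [|k IH] n u.
  by apply: Ck_0; apply: differentiable_continuous; apply/derivable1_diffP;
    exact: (@ex_derive _ _ _ _ _ _ _ (is_derive_flat n u)).
apply: (@Ck_derive _ _ _ (fun v => flat n.+2 v - n%:R * flat n.+1 v)).
  by apply: filterE => v; exact: is_derive_flat.
by apply: Ck_sub; [exact: IH|apply: Ck_mul; [exact: Ck_cst|exact: IH]].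
Qed.

(** The derivative of [flat 0] is [flat 2], which is at most [2!]. *)
Lemma flat0_lip (a b : R) : `|flat 0 a - flat 0 b| <= 2 * `|a - b|.
Proof.
apply: (@is_derive_lip _ (flat 2)) => x.
  by have := is_derive_flat 0 x; rewrite mul0r subr0.
by rewrite ger0_norm ?flat_ge0//; exact: flat_le.
Qed.

End Flat.

(** * Agreement of pointwise C^k regularity with [Cp_smooth] *)

Section CpSmooth.
Context {R : realType} {X : normedModType R}.

Definition tw (j : nat) (v : j.-tuple X) : R := \prod_(y <- v) `|y|.

Lemma tw_ge0 j v : 0 <= @tw j v.
Proof. by rewrite /tw prodr_ge0. Qed.

(** Vectors are normalised one after the other and moved to the prefix [s]. This turns bounds on
    [unit_list] into bounds by the product of the norms. *)
Lemma multilinear_scale j (L : seq X -> R) (s t : seq X) :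
  multilinear j L -> (size s + size t)%N = j ->
  L (s ++ t) = \prod_(y <- t) `|y| * L (s ++ [seq `|y|^-1 *: y | y <- t]).
Proof.
move=> mL; elim: t s => [|y t IH] s st; first by rewrite big_nil mul1r.
have L0 : L (s ++ 0 :: t) = 0.
  have := mL s t _ 1 0 0; rewrite -st addnS => /(_ erefl).
  by rewrite scaler0 addr0 mul1r => /eqP; rewrite -subr_eq0 opprD addrA subrr sub0r oppr_eq0 => /eqP.
have {1}-> : y = `|y| *: (`|y|^-1 *: y) + 0.
  have [->|y0] := eqVneq y 0; first by rewrite normr0 scale0r addr0.
  by rewrite scalerA divff ?normr_eq0// scale1r addr0.
rewrite mL; last by rewrite -st addnS.
rewrite L0 addr0 -cat_rcons IH; last by rewrite size_rcons addSn -addnS.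
by rewrite cat_rcons big_cons /= mulrA.
Qed.

Lemma multilinear_bound j (L : seq X -> R) (e : R) :
  multilinear j L -> (forall v, unit_list j v -> `|L v| <= e) ->
  forall v, size v = j -> `|L v| <= e * \prod_(y <- v) `|y|.
Proof.
move=> mL bL v sv; have := @multilinear_scale j L [::] v mL sv.
rewrite /= => ->; rewrite normrM ger0_norm ?prodr_ge0// mulrC ler_wpM2r ?prodr_ge0//.
apply: bL; split; first by rewrite size_map.
move=> y /mapP[z _ ->]; rewrite normrZ normfV normr_id.
have [->|z0] := eqVneq z 0; first by rewrite normr0 mulr0.
by rewrite mulVf ?normr_eq0.
Qed.

Lemma multilinear_sub j (L M : seq X -> R) :
  multilinear j L -> multilinear j M -> multilinear j (fun v => L v - M v).
Proof. by move=> mL mM s t st a y z; rewrite mL// mM//; ring. Qed.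

Lemma multilinear_cons j (L : seq X -> R) h :
  multilinear j.+1 L -> multilinear j (fun v => L (h :: v)).
Proof. by move=> mL s t st a y z; rewrite -!cat_cons mL//= addSn st. Qed.

Lemma unit_list_tw j (v : seq X) (s : size v == j) : unit_list j v -> tw (Tuple s) <= 1.
Proof.
move=> [_ uv]; rewrite /tw /= big_seq; apply: Num.Theory.prodr_ile1 => y /uv ->.
by rewrite normr_ge0.
Qed.

(** [D j] is read as a family over [j]-tuples weighted by [tw]; as in [frechet_step], a new
    increment is put in front of the list. *)
Lemma Cp_smooth_Ck p (f : X -> R) k x :
  Cp_smooth p f -> le_order k p -> Ck k f x.
Proof.
move=> [D [D0 [Dm [Df Dc]]]] kp.
have le_orderW i j : (i <= j)%N -> le_order j p -> le_order i p.
  by case: p {kp Dm Df Dc} => //= n ij; exact: leq_trans.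
have H : forall k j x, le_order (j + k) p ->
    Ck_family k (@tw j) (fun y (v : j.-tuple X) => D j y v) x.
  { elim=> [|i IH] j {}x jk.
  all: have jp : le_order j p by apply: le_orderW jk; rewrite leq_addr.
  all: have [mD [C bD]] := Dm j x jp.
  all: have bF : bdd_family (@tw j) (fun v : j.-tuple X => D j x v).
  1,3: (split; first exact: tw_ge0);
    exists `|C| => // v; apply: le_trans (bD _ (size_tuple v)) _;
    by apply: ler_wpM2r; [exact: tw_ge0|exact: ler_norm].
    split=> // e e0; have [d [d0 H]] := Dc j x jp e e0.
    apply/nbhs_normP; exists d => //= y; rewrite /= distrC => yx v.
    apply: (@multilinear_bound j (fun v => D j y v - D j x v)).
    + by apply: multilinear_sub => //; have [] := Dm j y jp.
    + exact: H.
    + exact: size_tuple.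
  have j1p : le_order j.+1 p by apply: le_orderW jk; rewrite addnS ltnS leq_addr.
  apply: (@Ck_familyS _ _ _ _ _ _ (fun y (vh : j.-tuple X * X) => D j.+1 y (vh.2 :: vh.1))) => //.
    apply: nearW => y; have [mD1 [C1 bD1]] := Dm j.+1 y j1p.
    split.
    - move=> v a h l /=; rewrite -[_ :: _]/([::] ++ _) mD1//=.
      by rewrite size_tuple.
    - split; first by apply: dweight_ge0; exact: tw_ge0.
      exists `|C1| => // -[v h] /=; apply: le_trans (bD1 _ _) _.
        by rewrite /= size_tuple.
      rewrite big_cons /dweight/= [`|h| * _]mulrC; apply: ler_wpM2r; last exact: ler_norm.
      by rewrite mulr_ge0// prodr_ge0.
    move=> e e0; have [d [d0 H]] := Df j y j1p e e0.
    apply/nbhs_normP; exists d => //= z; rewrite /= distrC => zy v.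
    rewrite mulrCA mulrC.
    apply: (@multilinear_bound j (fun v => D j z v - D j y v - D j.+1 y ((z - y) :: v))).
    - apply: multilinear_sub; last exact: multilinear_cons.
      by apply: multilinear_sub; [have [] := Dm j z jp|have [] := Dm j y jp].
    - by move=> w uw; have := H _ zy w uw; rewrite [y + _]addrC subrK.
    - exact: size_tuple.
  have jk1 : le_order (j.+1 + i) p by rewrite addSn -addnS.
  move: (IH j.+1 x jk1) => /(@Ck_family_reindex _ _ _ _ (j.-tuple X * X)%type _ (dweight (@tw j))
    (fun vh => [tuple of vh.2 :: vh.1]) 1); apply => //.
    by apply: dweight_ge0; exact: tw_ge0.
  by move=> vh; rewrite mul1r /tw /dweight /= big_cons mulrC. }
have := H k 0%N x; rewrite add0n => /(_ kp) /(@Ck_family_reindex _ _ _ _ unit _ w1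
  (fun=> [tuple]) 1) H0.
apply: (@Ck_family_near _ _ _ _ _ (fun y _ => D 0%N y [::])).
  by apply: nearW => y; rewrite D0.
apply: H0 => //.
by move=> w; rewrite /tw big_nil /w1 mul1r.
Qed.

Lemma fder_is_derive V (N : V -> R) (F : X -> V -> R) x L v h :
  (forall v, 0 <= N v) -> fder N F x L ->
  is_derive x h (fun y => F y v) (L (v, h)).
Proof.
move=> N0 [lin _ est].
have L0 : L (v, 0) = 0.
  by have := lin v 1 0 0; rewrite scale1r addr0 mul1r => /eqP; rewrite -subr_eq0 opprD addrA subrr sub0r oppr_eq0 => /eqP.
have H : t^-1 *: (F (t *: h + x) v - F x v) @[t --> 0^'] --> L (v, h).
  apply/cvgrPdist_le => e e0.
  pose M := N v * `|h| + 1; have M0 : 0 < M by rewrite /M ltr_wpDl// mulr_ge0.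
  have d0 : 0 < e / M by rewrite divr_gt0.
  have cx : t *: h + x @[t --> (0 : R)^'] --> x.
    rewrite -[X in _ --> X]add0r -[X in _ --> X + _](scale0r h); apply: cvgD; last exact: cvg_cst.
    by apply: cvgZr_tmp; exact: cvg_within.
  have /cx est' := est _ d0.
  near=> t; have t0 : t != 0 by near: t; exact: nbhs_dnbhs_neq.
  have : forall v, `|F (t *: h + x) v - F x v - L (v, t *: h + x - x)| <= e / M * (N v * `|t *: h + x - x|) by near: t.
  move=> /(_ v); rewrite addrK.
  have -> : L (v, t *: h) = t * L (v, h) by rewrite -[t *: h]addr0 lin L0 addr0.
  rewrite normrZ => K.
  have -> : L (v, h) - t^-1 *: (F (t *: h + x) v - F x v) = - (t^-1 * (F (t *: h + x) v - F x v - t * L (v, h))).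
    by rewrite /GRing.scale/=; field.
  rewrite normrN normrM normfV ler_pdivrMl ?normr_gt0//.
  apply: le_trans K _.
  have -> : e / M * (N v * (`|t| * `|h|)) = `|t| * e * (N v * `|h| / M) by ring.
  apply: ler_piMr; first by rewrite mulr_ge0// ltW.
  by rewrite ler_pdivrMr// mul1r lerDl.
split; first by apply/cvg_ex; exists (L (v, h)).
exact: cvg_lim H.
Unshelve. all: by end_near. Qed.

(** [Ck] provides derivatives near each point separately, with no common choice, whereas [Cp_smooth]
    wants one global family. Iterated directional derivatives are canonical and agree with every
    local choice. Lists that are too short get the value 0. *)
Fixpoint dirD (f : X -> R) (k : nat) (x : X) (v : seq X) : R :=
  match k, v with
  | 0%N, _ => f x
  | k'.+1, h :: v' => 'D_h (fun y => dirD f k' y v') x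
  | _, [::] => 0
  end.

Lemma Ck_Cp_smooth p (f : X -> R) :
  (forall k x, le_order k p -> Ck k f x) -> Cp_smooth p f.
Proof.
move=> Cf; exists (dirD f).
have H : forall j k x, le_order (j + k) p ->
    Ck_family k (@tw j) (fun y (v : j.-tuple X) => dirD f j y v) x.
  elim=> [|j IH] k x jk.
    move: (Cf _ x jk) => /(@Ck_family_reindex _ _ _ _ (0.-tuple X) _ (@tw 0)
      (fun=> tt) 1); apply=> //; first exact: tw_ge0.
    by move=> v; rewrite /tw tuple0 big_nil mul1r.
  have [_ _ [F' dF CF]] : Ck_family k.+1 (@tw j) (fun y (v : j.-tuple X) => dirD f j y v) x.
    by apply: IH; rewrite addnS -addSn.
  move: CF => /(@Ck_family_reindex _ _ _ _ (j.+1.-tuple X) _ (@tw j.+1)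
    (fun v => ([tuple of behead v], thead v)) 1) CF.
  apply: Ck_family_near (CF _ _ _) => //; last 2 first.
  - exact: tw_ge0.
  - by move=> v; case/tupleP: v => h v; rewrite /dweight/= theadE /tw mul1r /= big_cons mulrC.
  apply: filterS dF => y dF; apply/funext => v; case/tupleP: v => h v.
  rewrite theadE /=.
  have -> : [tuple of behead [tuple of h :: v]] = v by apply: val_inj.
  by have := fder_is_derive v h (@tw_ge0 j) dF => dd; rewrite (@derive_val _ _ _ _ _ _ _ dd).
have le_orderW i j : (i <= j)%N -> le_order j p -> le_order i p.
  by case: p {Cf H} => //= n ij; exact: leq_trans.
have Fd j x : le_order j.+1 p -> exists2 L, fder (@tw j) (fun y (v : j.-tuple X) => dirD f j y v) x L &
    forall h v (sv : size v == j), L (Tuple sv, h) = dirD f j.+1 x (h :: v).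
  move=> jp; have := H j 1%N x; rewrite addn1 => /(_ jp) [_ _ [F' /nbhs_singleton dF _]].
  exists (F' x) => // h v sv.
  by have dd := fder_is_derive (Tuple sv) h (@tw_ge0 j) dF; rewrite /= (@derive_val _ _ _ _ _ _ _ dd).
(* The first slot is linear because a derivative is; the other slots are linear by induction, since
   differentiation in the direction [h] is. *)
have mult : forall j x, le_order j p -> multilinear j (dirD f j x).
  elim=> [|j IH] x jp; first by move=> s t.
  have jp' : le_order j p by exact: le_orderW jp.
  have [L [linL _ _] LE] := Fd j x jp.
  have dv h v : size v = j -> derivable (fun y => dirD f j y v) x h.
    move=> /eqP sv; have [L' dL' _] := Fd j x jp.
    exact: (@ex_derive _ _ _ _ _ _ _ (fder_is_derive (Tuple sv) h (@tw_ge0 j) dL')).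
  case=> [|h s] t [st] a y z.
    by have /eqP sv : size t = j := st; rewrite !cat0s -!(LE _ _ sv) linL.
  rewrite /=; have E : (fun y0 => dirD f j y0 (s ++ (a *: y + z) :: t)) =
    a \*: (fun y0 => dirD f j y0 (s ++ y :: t)) + (fun y0 => dirD f j y0 (s ++ z :: t)).
    by apply/funext => w; rewrite !fctE IH.
  have sz u : size (s ++ u :: t) = j by rewrite size_cat /= addnS.
  rewrite E deriveD; [|by apply: derivableZ; apply: dv|exact: dv].
  by rewrite deriveZ//; exact: dv.
split; [by []|split; [|split]].
- move=> k x kp; split; first exact: mult.
  have [_ [C _ bC]] : bdd_family (@tw k) (fun v : k.-tuple X => dirD f k x v).
    by apply: (@Ck_family_bdd _ _ 0 _ _ (fun y (v : k.-tuple X) => dirD f k y v)); apply: H; rewrite addn0.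
  by exists C => v /eqP sv; have := bC (Tuple sv).
- move=> k x kp e e0; have [L [_ _ est] LE] := Fd k x kp.
  have /nbhs_normP[d d0 K] := est e e0; exists d; split=> // h hd v uv.
  have sv : size v == k by apply/eqP; case: uv.
  have := K (x + h); rewrite /ball_/= opprD addrA subrr sub0r normrN => /(_ hd (Tuple sv)).
  rewrite [x + h - x]addrAC subrr add0r LE => /le_trans; apply.
  apply: ler_wpM2l; first exact: ltW.
  by rewrite -[leRHS]mul1r ler_wpM2r//; exact: unit_list_tw.
move=> k x kp e e0.
have /Ck_family_cont/(_ _ e0)/nbhs_normP[d d0 K] := H k 0%N x ltac:(by rewrite addn0).
exists d; split=> // y; rewrite distrC => yx v uv.
have sv : size v == k by apply/eqP; case: uv.
have := K _ yx (Tuple sv) => /le_trans; apply.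
by rewrite -[leRHS]mulr1; apply: ler_wpM2l; [exact: ltW|exact: unit_list_tw].
Qed.

End CpSmooth.

(** * Norming functionals and semi-biorthogonal sequences *)

Section NormingFunctional.
Context {R : realType} {X : normedModType R}.

Definition sublinear (q : X -> R) : Prop :=
  (forall x y, q (x + y) <= q x + q y) /\
  (forall t x, 0 <= t -> q (t *: x) = t * q x).

Lemma sublinear0 q : sublinear q -> q 0 = 0.
Proof. by move=> [_ /(_ 0 0 (lexx 0))]; rewrite scale0r mul0r. Qed.

Lemma sublinear_lb q x : sublinear q -> - q (- x) <= q x.
Proof.
move=> sq; have := sq.1 x (- x); rewrite subrr (sublinear0 sq); lra.
Qed.

(** Lies below [q] and takes at [- y] a value at most [- q y]. A minimal [q] must coincide with it,
    which yields additivity; applied to the norm, it forces a form to attain the norm of [y]. *)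
Definition ray_inf (q : X -> R) (y x : X) : R :=
  inf [set q (x + t *: y) - t * q y | t in [set t | 0 <= t]].

Lemma ray_has_inf q y x : sublinear q ->
  has_inf [set q (x + t *: y) - t * q y | t in [set t | 0 <= t]].
Proof.
move=> sq; split; first by exists (q (x + 0 *: y) - 0 * q y); exists 0 => /=.
exists (- q (- x)) => _ [t /= t0 <-].
have := sq.1 (x + t *: y) (- x); rewrite addrAC subrr add0r sq.2//; lra.
Qed.

Lemma ray_inf_le q y x t : sublinear q -> 0 <= t ->
  ray_inf q y x <= q (x + t *: y) - t * q y.
Proof.
by move=> sq t0; apply: ge_inf; [have [] := ray_has_inf y x sq|exists t].
Qed.

Lemma ray_inf_lt q y x e : sublinear q -> 0 < e ->
  exists2 t, 0 <= t & q (x + t *: y) - t * q y < ray_inf q y x + e.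
Proof.
move=> sq e0; have [_ [t t0 <-] H] := inf_adherent e0 (ray_has_inf y x sq).
by exists t.
Qed.

Lemma ray_infP q y x z : sublinear q ->
  (forall t, 0 <= t -> z <= q (x + t *: y) - t * q y) -> z <= ray_inf q y x.
Proof.
move=> sq H; apply: lb_le_inf; first by have [] := ray_has_inf y x sq.
by move=> _ [t t0 <-]; exact: H.
Qed.

Lemma ray_inf_sublinear q y : sublinear q -> sublinear (ray_inf q y).
Proof.
move=> sq; split.
  move=> x1 x2; apply/ler_addgt0Pr => e e0.
  have e2 : 0 < e / 2 by rewrite divr_gt0.
  have [t1 t10 H1] := ray_inf_lt y x1 sq e2.
  have [t2 t20 H2] := ray_inf_lt y x2 sq e2.
  have := ray_inf_le y (x1 + x2) sq (addr_ge0 t10 t20).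
  have -> : x1 + x2 + (t1 + t2) *: y = (x1 + t1 *: y) + (x2 + t2 *: y)
    by rewrite scalerDl addrACA.
  have := sq.1 (x1 + t1 *: y) (x2 + t2 *: y); lra.
have le_scale t x : 0 < t -> t * ray_inf q y x <= ray_inf q y (t *: x).
  move=> t0; apply: ray_infP => // s s0.
  have := ray_inf_le y x sq (divr_ge0 s0 (ltW t0)).
  have E : t * (s / t) = s by rewrite mulrC divfK// gt_eqF.
  rewrite -(ler_pM2l t0) mulrBr -(sq.2 _ _ (ltW t0)) scalerDr scalerA.
  by rewrite E [t * (_ * _)]mulrA E.
move=> t x; rewrite le_eqVlt => /orP[/eqP<-|t0].
  rewrite scale0r mul0r; apply/eqP; rewrite eq_le; apply/andP; split.
    by have := ray_inf_le y 0 sq (lexx 0); rewrite scale0r addr0 mul0r subr0 (sublinear0 sq).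
  by apply: ray_infP => // s s0; rewrite add0r sq.2// subrr.
apply/eqP; rewrite eq_le le_scale// andbT.
have := le_scale t^-1 (t *: x); rewrite invr_gt0 => /(_ t0).
by rewrite scalerA mulVf ?gt_eqF// scale1r -(ler_pM2l t0) mulrA divff ?gt_eqF// mul1r.
Qed.

(* A minimal sublinear functional is linear: this proves the Hahn-Banach theorem
   without extending forms from subspaces. *)
Lemma minimal_sublinear_additive q : sublinear q ->
  (forall q', sublinear q' -> (forall x, q' x <= q x) -> q' = q) ->
  forall x y, q (x + y) = q x + q y.
Proof.
move=> sq minq x y; apply/eqP; rewrite eq_le sq.1 /=.
have E : ray_inf q y = q.
  apply: minq; first exact: ray_inf_sublinear.
  by move=> z; have := ray_inf_le y z sq (lexx 0); rewrite scale0r addr0 mul0r subr0.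
have := ray_inf_le y x sq ler01; rewrite E scale1r mul1r; lra.
Qed.

(** Zorn's lemma for the reversed pointwise order. A nonempty chain is bounded by its pointwise
    infimum, which is finite because a sublinear function below [p] is at least [- p (- x)] at [x];
    the empty chain is bounded by [p]. *)
Lemma minimal_sublinear_below (p : X -> R) : sublinear p ->
  exists q, [/\ sublinear q, forall x, q x <= p x &
    forall q', sublinear q' -> (forall x, q' x <= q x) -> q' = q].
Proof.
move=> sp.
pose T := {q : X -> R | sublinear q /\ forall x, q x <= p x}.
pose rel (s t : T) := `[< forall x, sval t x <= sval s x >].
have [||||t tmax] := @Zorn T rel.
- by move=> t; apply/asboolP.
- move=> r s t /asboolP rs /asboolP st; apply/asboolP => x.
  exact: le_trans (st x) (rs x).
- move=> [s ps] [t pt] /asboolP/= st /asboolP/= ts.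
  have E : s = t by apply/funext => x; apply/eqP; rewrite eq_le st ts.
  by subst t; congr exist; exact: Prop_irrelevance.
- move=> A totA; have [[s0 As0]|A0] := pselect (exists s, A s); last first.
    by exists (exist _ p (conj sp (fun x => lexx (p x)))) => s As; case: A0; exists s.
  pose S x := [set sval s x | s in A].
  have hS x : has_inf (S x).
    split; first by exists (sval s0 x); exists s0.
    exists (- p (- x)) => _ [s _ <-]; have [sq le] := svalP s.
    have := sublinear_lb x sq; have := le (- x); lra.
  pose q x := inf (S x).
  have qle s x : A s -> q x <= sval s x.
    by move=> As; apply: ge_inf; [case: (hS x)|exists s].
  have sq : sublinear q.
    split.
      move=> x y; apply/ler_addgt0Pr => e e0.
      have e2 : 0 < e / 2 by rewrite divr_gt0.
      have [_ [s As <-] H1] := inf_adherent e2 (hS x).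
      have [_ [t At <-] H2] := inf_adherent e2 (hS y).
      (* Near-minimisers at [x] and at [y] may differ; the smaller of the two in the chain serves
         both points. *)
      have [/asboolP st|/asboolP ts] := totA _ _ As At.
        have := qle t (x + y) At; have := (svalP t).1.1 x y; have := st x.
        rewrite -/(q x) in H1; rewrite -/(q y) in H2; lra.
      have := qle s (x + y) As; have := (svalP s).1.1 x y; have := ts y.
      rewrite -/(q x) in H1; rewrite -/(q y) in H2; lra.
    have qge x z : (forall s, A s -> z <= sval s x) -> z <= q x.
      by move=> H; apply: lb_le_inf; [case: (hS x)|move=> _ [s As <-]; exact: H].
    have sc t x : 0 < t -> t * q x <= q (t *: x).
      move=> t0; apply: qge => s As; rewrite ((svalP s).1.2 _ _ (ltW t0)).
      by rewrite ler_pM2l//; exact: qle.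
    move=> t x; rewrite le_eqVlt => /orP[/eqP<-|t0].
      rewrite scale0r mul0r; apply/eqP; rewrite eq_le; apply/andP; split.
        by apply: le_trans (qle _ _ As0) _; rewrite (sublinear0 (svalP s0).1).
      by apply: qge => s As; rewrite (sublinear0 (svalP s).1).
    apply/eqP; rewrite eq_le sc// andbT.
    have := sc t^-1 (t *: x); rewrite invr_gt0 => /(_ t0).
    by rewrite scalerA mulVf ?gt_eqF// scale1r -(ler_pM2l t0) mulrA divff ?gt_eqF// mul1r.
  have qp x : q x <= p x by apply: le_trans (qle _ _ As0) _; exact: (svalP s0).2.
  exists (exist _ q (conj sq qp)) => s As; apply/asboolP => x; exact: qle.
- have [st tp] := svalP t; exists (sval t); split=> // q' sq' le.
  have q'p x : q' x <= p x by exact: le_trans (le x) (tp x).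
  have := tmax (exist _ q' (conj sq' q'p)).
  have H : rel t (exist _ q' (conj sq' q'p)) by apply/asboolP.
  by move=> /(_ H) /(congr1 sval).
Qed.

Definition contractive_form (xi : X -> R) : Prop :=
  (forall a h k, xi (a *: h + k) = a * xi h + xi k) /\
  (forall h, `|xi h| <= `|h|).

Lemma norming_form (e : X) :
  exists xi, contractive_form xi /\ xi e = `|e|.
Proof.
have sn : sublinear (fun x : X => `|x|).
  split; first exact: ler_normD.
  by move=> t x t0; rewrite normrZ ger0_norm.
have [xi [sxi xile ximin]] := minimal_sublinear_below (ray_inf_sublinear e sn).
have xiD := minimal_sublinear_additive sxi ximin.
have xiN x : xi (- x) = - xi x.
  by have := xiD x (- x); rewrite subrr (sublinear0 sxi); lra.
have xile' x : xi x <= `|x|.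
  apply: le_trans (xile x) _.
  by have := ray_inf_le e x sn (lexx 0); rewrite scale0r addr0 mul0r subr0.
have xinorm x : `|xi x| <= `|x|.
  by rewrite ler_norml xile' andbT lerNl -xiN -normrN xile'.
exists xi; split.
  split=> // a h k; rewrite xiD; congr (_ + _).
  have [a0|a0] := leP 0 a; first by rewrite sxi.2.
  have : xi ((- a) *: h) = - a * xi h by rewrite sxi.2// oppr_ge0 ltW.
  by rewrite scaleNr xiN; lra.
apply/eqP; rewrite eq_le xile' /=.
have := xile (- e); have := ray_inf_le e (- e) sn ler01.
by rewrite scale1r addNr normr0 mul1r xiN; lra.
Qed.

Lemma contractive_formB xi x y : contractive_form xi -> xi (x - y) = xi x - xi y.
Proof.
move=> [lin _]; have := lin (-1) y x.
by rewrite scaleN1r mulN1r ![- _ + _]addrC.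
Qed.

Lemma contractive_form0 xi : contractive_form xi -> xi 0 = 0.
Proof. by move=> cx; have := contractive_formB 0 0 cx; rewrite !subrr. Qed.

Lemma contractive_formD xi x y : contractive_form xi -> xi (x + y) = xi x + xi y.
Proof. by move=> [lin _]; rewrite -{1}[x]scale1r lin mul1r. Qed.

Lemma contractive_formZ xi a x : contractive_form xi -> xi (a *: x) = a * xi x.
Proof. by move=> cx; rewrite -[a *: x]addr0 cx.1 (contractive_form0 cx) addr0. Qed.

(** Evaluating [n] forms on [n + 1] independent vectors gives a matrix with a nonzero left kernel; a
    row of it holds the coefficients of [e]. *)
Lemma common_kernel n (xi : nat -> X -> R) : infinite_dimensional X ->
  (forall i, (i < n)%N -> contractive_form (xi i)) ->
  exists2 e, `|e| = 1 & forall i, (i < n)%N -> xi i e = 0.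
Proof.
move=> /(_ n.+1)[v vfree] cxi.
pose M := \matrix_(i < n.+1, j < n) xi j (v i).
have K0 : kermx M != 0.
  rewrite kermx_eq0 /row_free neq_ltn; apply/orP; left.
  by rewrite ltnS rank_leq_col.
pose c := nz_row (kermx M).
have c0 : c != 0 by rewrite nz_row_eq0.
have cM : c *m M = 0.
  by apply/sub_kermxP; exact: nz_row_sub.
pose e := \sum_i c 0 i *: v i.
have e0 : e != 0.
  apply: contra_neq c0 => /vfree H; apply/rowP => i; rewrite mxE; exact: H.
have e1 : 0 < `|e| by rewrite normr_gt0.
exists (`|e|^-1 *: e); first by rewrite normrZ normfV normr_id mulVf// gt_eqF.
move=> i ilt; have ci := cxi i ilt; rewrite contractive_formZ//.
apply/eqP; rewrite mulf_eq0; apply/orP; right; apply/eqP.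
rewrite /e (big_morph (xi i) (fun x y => contractive_formD x y ci) (contractive_form0 ci)).
have := congr1 (fun A : 'rV_n => A 0 (Ordinal ilt)) cM; rewrite !mxE => E.
rewrite -[RHS]E; apply: eq_bigr => j _; rewrite mxE; exact: contractive_formZ.
Qed.

(** Choose [E n] of norm 1 in the common kernel of the earlier forms, then let [xi n] norm it. The
    values of [xi n] at earlier vectors remain arbitrary in [-1, 1]. *)
Lemma semibiorthogonal : infinite_dimensional X ->
  exists (E : nat -> X) (xi : nat -> X -> R),
    [/\ forall n, contractive_form (xi n), forall n, `|E n| = 1,
        forall n, xi n (E n) = 1 & forall j n, (j < n)%N -> xi j (E n) = 0].
Proof.
move=> dimX.
have /choice[pick pickP] : forall s : nat * (nat -> X -> R), exists p : X * (X -> R),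
    (forall i, (i < s.1)%N -> contractive_form (s.2 i)) ->
    [/\ contractive_form p.2, `|p.1| = 1, p.2 p.1 = 1 &
        forall i, (i < s.1)%N -> s.2 i p.1 = 0].
  move=> [n xi] /=; have [H|H] := pselect (forall i, (i < n)%N -> contractive_form (xi i)).
    have [e e1 ke] := common_kernel dimX H.
    have [z [cz ze]] := norming_form e.
    by exists (e, z) => _; split=> //=; rewrite ze.
  by exists (0, fun=> 0).
pose upd (xi : nat -> X -> R) n z := fun i => if i == n then z else xi i.
(* The recursion carries its history: [F n] holds the forms chosen before stage [n] and is 0 from
   index [n] on. *)
pose F := fix F n : nat -> X -> R :=
  if n is m.+1 then upd (F m) m (pick (m, F m)).2 else fun _ _ => 0.
have Fstable n i : (i < n)%N -> F n i = F i.+1 i.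
  elim: n => [//|n IH]; rewrite ltnS leq_eqVlt => /orP[/eqP->//|ilt].
  by rewrite -IH//= /upd ltn_eqF.
have FC n : forall i, (i < n)%N -> contractive_form (F n i).
  elim: n => [//|n IH] i; rewrite ltnS leq_eqVlt /= /upd.
  case: eqVneq => [-> _|_ /= ilt]; last exact: IH.
  by case: (pickP (n, F n) IH).
exists (fun n => (pick (n, F n)).1), (fun n => (pick (n, F n)).2); split.
- by move=> n; case: (pickP (n, F n) (FC n)).
- by move=> n; case: (pickP (n, F n) (FC n)).
- by move=> n; case: (pickP (n, F n) (FC n)).
move=> j n jn; case: (pickP (n, F n) (FC n)) => _ _ _ /(_ j jn) /=.
by rewrite Fstable//= /upd eqxx.
Qed.

End NormingFunctional.

(** * The drift: a bounded curve with separated values *)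

Section Omega.
Context {R : realType}.

(** A bump supported in [-1, 1]. The factor [expR 2] makes it at least 1 for [|s| <= 1/2], where
    [1 / (1 - s * s)] is at most 4/3. *)
Definition omega (s : R) : R := expR 2 * flat 0 (1 - s * s).

Lemma omega_ge0 s : 0 <= omega s.
Proof. by rewrite mulr_ge0 ?expR_ge0 ?flat_ge0. Qed.

Lemma omega_le s : omega s <= expR 2.
Proof.
rewrite /omega -[leRHS]mulr1 ler_wpM2l ?expR_ge0//; exact: (flat_le 0).
Qed.

Lemma omega_out s : 1 <= `|s| -> omega s = 0.
Proof.
move=> s1; rewrite /omega flat_le0 ?mulr0// -expr2 -real_normK ?num_real//.
by rewrite subr_le0 exprn_ege1.
Qed.

Lemma omega_in s : `|s| <= 1 / 2 -> 1 <= omega s.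
Proof.
move=> s1.
have s2 : s * s <= 1 / 4.
  rewrite -expr2 -real_normK ?num_real//.
  have := normr_ge0 s; nra.
have u0 : 0 < 1 - s * s by lra.
rewrite /omega /flat u0 expr0 mul1r -expRD -[leLHS]expR0 ler_expR subr_ge0.
by rewrite -[leLHS]mul1r ler_pdivrMr//; lra.
Qed.

Lemma omega_lip s t : `|s - t| <= 1 -> `|omega s - omega t| <= 8 * expR 2 * `|s - t|.
Proof.
move=> st.
have E0 : 0 < expR (2 : R) by exact: expR_gt0.
have [[s1 t1]|H] := pselect (1 <= `|s| /\ 1 <= `|t|).
  by rewrite !omega_out// subrr normr0 mulr_ge0// ltW// mulr_gt0.
(* One of the two points has absolute value below 1 and the other is within distance 1 of it. *)
have s2 : `|s + t| <= 4.
  have h1 := ler_normD (s - t) t; have h2 := ler_normD (t - s) s.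
  rewrite subrK in h1; rewrite subrK distrC in h2.
  have h3 := ler_normD s t.
  have [s1|s1] := leP 1 `|s|; last lra.
  by have [t1|t1] := leP 1 `|t|; [case: H|lra].
rewrite /omega -mulrBr normrM (gtr0_norm E0).
have h := flat0_lip (1 - s * s) (1 - t * t); move: h.
have -> : 1 - s * s - (1 - t * t) = - ((s - t) * (s + t)) by ring.
rewrite normrN normrM => h.
have h2 : `|s - t| * `|s + t| <= `|s - t| * 4 by rewrite ler_wpM2l.
have : expR 2 * `|flat 0 (1 - s * s) - flat 0 (1 - t * t)| <= expR 2 * (8 * `|s - t|).
  by rewrite ler_pM2l//; lra.
by move/le_trans; apply; rewrite mulrCA mulrA.
Qed.

Lemma Ck_omega k (s : R) : Ck k omega s.
Proof.
apply: Ck_mul; first exact: Ck_cst.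
apply: (@Ck_comp _ _ _ (flat 0) (fun s : R => 1 - s * s)); first exact: Ck_flat.
by apply: Ck_sub; [exact: Ck_cst|apply: Ck_mul; exact: Ck_id].
Qed.

(** Counts the terms of the drift that can matter at [phi] or at any parameter within distance 1 of
    it; this makes the bounds on [sigma] independent of the number of terms. *)
Lemma sum_near_le (N : nat) (phi : R) :
  \sum_(i < N) (`|phi - i%:R| < 2)%R%:R <= 4 :> R.
Proof.
wlog p0 : phi / 0 <= phi.
  move=> W; have [/W//|p0] := leP 0 phi; apply: le_trans (W 0 (lexx 0)).
  apply: ler_sum => i _; rewrite ler_nat; case: ltP => [ip|_]; last by case: ltP.
  suff -> : `|0 - i%:R| < 2 :> R by [].
  rewrite sub0r normrN ger0_norm//.
  by move: ip; rewrite ltr_norml => /andP[ip _]; lra.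
pose m := Num.truncn phi.
have /andP[m1 m2] : m%:R <= phi < m.+1%:R by exact: truncn_itv.
have one c : \sum_(i < N) ((i : nat) == c)%:R <= 1 :> R.
  have [cN|cN] := ltnP c N.
    rewrite (bigD1 (Ordinal cN))//= eqxx big1 ?addr0// => i.
    by rewrite -val_eqE /= => /negbTE ->.
  rewrite big1// => i _; case: eqP => // ic; have := ltn_ord i; rewrite ic ltnNge cN//.
(* With [m] the integer part of [phi], the candidates are [m - 1], [m], [m + 1], [m + 2]; the first
   is written [i.+1 == m] to avoid truncated subtraction. *)
apply: (@le_trans _ _ (\sum_(i < N) (((i : nat).+1 == m)%:R + ((i : nat) == m)%:R
   + ((i : nat) == m.+1)%:R + ((i : nat) == m.+2)%:R))).
  apply: ler_sum => i _; case: ltP => [ip|_]; last by rewrite !addr_ge0.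
  have h1 : (m < i.+2)%N.
    by rewrite -(ltr_nat R); move: ip m1; rewrite ltr_norml -addn2 natrD => /andP[_]; lra.
  have h2 : (i < m.+3)%N.
    by rewrite -(ltr_nat R); move: ip m2; rewrite ltr_norml -addn2 -addn1 !natrD => /andP[]; lra.
  move: h1 h2; rewrite !ltnS.
  have : [|| (i.+1 == m), ((i : nat) == m), ((i : nat) == m.+1) | ((i : nat) == m.+2)] -> 
    1 <= ((i : nat).+1 == m)%:R + ((i : nat) == m)%:R
   + ((i : nat) == m.+1)%:R + ((i : nat) == m.+2)%:R :> R.
    do 4 case: eqP => //=; rewrite ?add0r ?addr0 => *; lra.
  by move=> H h1 h2; apply: H; lia.
rewrite !big_split/=.
have oneS : \sum_(i < N) ((i : nat).+1 == m)%:R <= 1 :> R.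
  case: m {m1 m2} => [|m]; last exact: one.
  by rewrite big1.
have := one m; have := one m.+1; have := one m.+2; lra.
Qed.

End Omega.

Section Sigma.
Context {R : realType} {X : normedModType R}.
Context (e : nat -> X) (zeta : nat -> X -> R) (K : R).
Context (K0 : 0 <= K) (en : forall i, `|e i| <= 1)
  (cz : forall i, contractive_form (zeta i)) (ze : forall i, zeta i (e i) = 1)
  (zk : forall j n, (j < n)%N -> zeta j (e n) = 0).

Definition sig (N : nat) (phi : R) : X := \sum_(i < N) (K * omega (phi - i%:R)) *: e i.

(** The terms with [i >= phi + 1] vanish, so this many terms stand for the whole series. *)
Definition sigma (phi : R) : X := sig (Num.truncn phi).+2 phi.

Lemma weight_ge0 s : 0 <= K * omega s.
Proof. exact: mulr_ge0 K0 (omega_ge0 s). Qed.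

Lemma truncn_lt (phi : R) : phi < (Num.truncn phi).+1%:R.
Proof.
have [p0|p0] := leP 0 phi; first by have /andP[] := truncn_itv p0.
by apply: lt_le_trans p0 _.
Qed.

Lemma sig_stable N M phi : (N <= M)%N -> phi + 1 <= N%:R -> sig M phi = sig N phi.
Proof.
move=> NM pN; rewrite /sig (big_ord_widen _ (fun i => (K * omega (phi - i%:R)) *: e i) NM).
rewrite [LHS](bigID (fun i : 'I_M => (i < N)%N))/= [X in _ + X]big1 ?addr0// => i.
rewrite -leqNgt -(ler_nat R) => Ni; rewrite omega_out ?mulr0 ?scale0r//.
by rewrite distrC ler_normr; apply/orP; left; lra.
Qed.

(** On a set of parameters bounded above, [sigma] is one fixed finite sum: this allows values to be
    subtracted term by term and the curve to be differentiated. *)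
Lemma sigmaE N phi : phi + 1 <= N%:R -> sigma phi = sig N phi.
Proof.
move=> pN; rewrite /sigma; set M := (Num.truncn phi).+2.
have pM : phi + 1 <= M%:R by have := truncn_lt phi; rewrite /M -addn1 natrD; lra.
by have [NM|/ltnW MN] := leqP N M; [exact: sig_stable|rewrite -(sig_stable MN)].
Qed.

Lemma sig_form xi N phi : contractive_form xi ->
  xi (sig N phi) = \sum_(i < N) K * omega (phi - i%:R) * xi (e i).
Proof.
move=> cxi; rewrite /sig.
rewrite (big_morph xi (fun x y => contractive_formD x y cxi) (contractive_form0 cxi)).
by apply: eq_bigr => i _; exact: contractive_formZ.
Qed.

Lemma sigma_ker xi phi : contractive_form xi -> (forall i, xi (e i) = 0) ->
  xi (sigma phi) = 0.
Proof.
by move=> cxi xe; rewrite /sigma sig_form// big1// => i _; rewrite xe mulr0.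
Qed.

Lemma sigma_le phi : `|sigma phi| <= K * expR 2 * 4.
Proof.
rewrite /sigma /sig; apply: le_trans (ler_norm_sum _ _ _) _.
have KE : 0 <= K * expR 2 by rewrite mulr_ge0// expR_ge0.
apply: le_trans (ler_wpM2l KE (sum_near_le (Num.truncn phi).+2 phi)).
rewrite mulr_sumr; apply: ler_sum => i _; rewrite normrZ.
case: ltP => [_|H]; last by rewrite omega_out ?mulr0 ?normr0 ?mul0r//; apply: le_trans H; lra.
rewrite mulr1 (ger0_norm (weight_ge0 _)).
rewrite -[leRHS]mulr1; apply: ler_pM => //; first exact: weight_ge0.
by apply: ler_wpM2l => //; exact: omega_le.
Qed.

Lemma sigma_lip phi psi : `|psi - phi| <= 1 ->
  `|sigma psi - sigma phi| <= K * (8 * expR 2) * 4 * `|psi - phi|.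
Proof.
move=> pp; pose N := maxn (Num.truncn phi).+2 (Num.truncn psi).+2.
have NP (p : R) : (Num.truncn p).+2%:R <= N%:R :> R -> p + 1 <= N%:R.
  by move=> h; have := truncn_lt p; move: h; rewrite -(addn1 (Num.truncn p).+1) natrD; lra.
rewrite (@sigmaE N phi) ?(@sigmaE N psi); last 2 first.
- by apply: NP; rewrite ler_nat leq_maxr.
- by apply: NP; rewrite ler_nat leq_maxl.
rewrite /sig -sumrB; apply: le_trans (ler_norm_sum _ _ _) _.
have KE : 0 <= K * (8 * expR 2) * `|psi - phi| by rewrite !mulr_ge0// expR_ge0.
rewrite [leRHS]mulrAC.
apply: le_trans (ler_wpM2l KE (sum_near_le N phi)).
rewrite mulr_sumr; apply: ler_sum => i _; rewrite -scalerBl -mulrBr normrZ normrM (ger0_norm K0).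
have E : psi - i%:R - (phi - i%:R) = psi - phi by ring.
case: ltP => [_|H].
  rewrite mulr1 -[leRHS]mulr1; apply: ler_pM => //; first by rewrite mulr_ge0.
  rewrite -mulrA; apply: ler_wpM2l => //.
  by have := @omega_lip _ (psi - i%:R) (phi - i%:R); rewrite E; apply.
rewrite mulr0 !omega_out ?subrr ?normr0 ?mulr0 ?mul0r//; first lra.
have := ler_normD (psi - i%:R) (phi - psi).
have -> : psi - i%:R + (phi - psi) = phi - i%:R by ring.
rewrite distrC in pp; lra.
Qed.

(** Let [m] be the integer part of [phi]. Both [zeta m] and [zeta m.+1] kill [sigma psi]: its terms
    up to [m + 1] vanish and the later ones lie in the kernels. On [sigma phi], [zeta m] reads
    [K * omega (phi - m)], which is enough if this [omega] is at least 1/4. Otherwise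
    [phi - m > 1/2], the term [m + 1] has weight at least [K], and in [zeta m.+1] the uncontrolled
    contribution of [e m] costs at most [K / 4]. *)
Lemma sigma_sep phi psi : 0 <= phi -> phi + 2 <= psi -> K / 4 <= `|sigma phi - sigma psi|.
Proof.
move=> p0 pp; pose m := Num.truncn phi.
have /andP[m1 m2] : m%:R <= phi < m.+1%:R by exact: truncn_itv.
have m2' : phi < m%:R + 1 by rewrite -(natrD R m 1) addn1.
have late j : (j <= m.+1)%N -> zeta j (sigma psi) = 0.
  rewrite -(ler_nat R) -addn1 natrD => jm; rewrite /sigma sig_form// big1// => i _.
  have [ji|ij] := ltnP j i; first by rewrite zk// mulr0.
  rewrite omega_out ?mulr0 ?mul0r//; move: ij; rewrite -(ler_nat R) => ij.
  by rewrite ler_normr; apply/orP; left; lra.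
have early : zeta m (sigma phi) = K * omega (phi - m%:R).
  rewrite /sigma sig_form// -/m (bigD1 (Ordinal (ltnW (ltnSn m.+1))))//= ze mulr1 big1 ?addr0// => i.
  rewrite -val_eqE /= neq_ltn => /orP[im|mi]; last by rewrite zk// mulr0.
  rewrite omega_out ?mulr0 ?mul0r//; move: im; rewrite -(ler_nat R) -addn1 natrD => im.
  by rewrite ler_normr; apply/orP; left; lra.
have early1 : zeta m.+1 (sigma phi) =
    K * omega (phi - m%:R) * zeta m.+1 (e m) + K * omega (phi - m.+1%:R).
  rewrite /sigma sig_form// -/m big_ord_recr/= ze mulr1; congr (_ + _).
  rewrite big_ord_recr/= big1 ?add0r// => i _.
  rewrite omega_out ?mulr0 ?mul0r//.
  have im := ltn_ord i; move: im; rewrite -(ler_nat R) -addn1 natrD => im.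
  by rewrite ler_normr; apply/orP; left; lra.
have H1 : `|K * omega (phi - m%:R)| <= `|sigma phi - sigma psi|.
  apply: le_trans ((cz m).2 _); rewrite (contractive_formB _ _ (cz m)) early late ?leqnSn//.
  by rewrite subr0.
have H2 : `|K * omega (phi - m%:R) * zeta m.+1 (e m) + K * omega (phi - m.+1%:R)|
    <= `|sigma phi - sigma psi|.
  apply: le_trans ((cz m.+1).2 _); rewrite (contractive_formB _ _ (cz m.+1)) early1 late//.
  by rewrite subr0.
have [w1|w1] := leP (1 / 4) (omega (phi - m%:R)).
  apply: le_trans H1; rewrite (ger0_norm (weight_ge0 _)).
  by rewrite ler_wpM2l//; lra.
have w2 : 1 <= omega (phi - m.+1%:R).
  apply: omega_in; rewrite -addn1 natrD.
  have : ~ (`|phi - m%:R| <= 1 / 2) by move=> /omega_in; lra.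
  move/negP; rewrite -ltNge lter_normr => /orP[h|h]; last lra.
  by rewrite ler_norml; apply/andP; split; lra.
apply: le_trans H2.
set a := K * omega _; set t := zeta _ _; set d := K * omega _.
have t1 : `|t| <= 1 by apply: le_trans ((cz m.+1).2 _) (en _).
have a0 : 0 <= a by exact: weight_ge0.
have a1 : a <= K * (1 / 4) by rewrite ler_wpM2l// ltW.
have d1 : K <= d by rewrite -[leLHS]mulr1 ler_wpM2l.
have : - a <= a * t.
  by move: t1; rewrite ler_norml => /andP[t1 _]; rewrite -mulrN1 ler_wpM2l.
move=> at1; apply: le_trans (ler_norm _); lra.
Qed.

End Sigma.

(** * The coil *)

Section RealLipschitz.
Context {R : realType}.

Lemma cos_lip (a b : R) : `|cos a - cos b| <= `|a - b|.
Proof.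
rewrite -[leRHS]mul1r; apply: (is_derive_lip (@is_derive_cos R)) => x.
by rewrite normrN ler_norml sin_geN1 sin_le1.
Qed.

Lemma sin_lip (a b : R) : `|sin a - sin b| <= `|a - b|.
Proof.
rewrite -[leRHS]mul1r; apply: (is_derive_lip (@is_derive_sin R)) => x.
by rewrite ler_norml cos_geN1 cos_le1.
Qed.

Lemma atan_lip (a b : R) : `|atan a - atan b| <= `|a - b|.
Proof.
rewrite -[leRHS]mul1r; apply: (is_derive_lip (@is_derive1_atan R)) => x.
have x0 := sqr_ge0 x.
by rewrite ger0_norm ?invr_ge0 ?addr_ge0// invf_le1 ?lerDl// ltr_wpDr.
Qed.

(** By the half-angle formulas, [cos (d / 2) = 0] would make [cos d] negative; hence
    [sin (d / 2) = 0] with [d / 2] in (-pi, pi). *)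
Lemma sin0_cos_gt0 (d : R) : sin d = 0 -> 0 < cos d -> `|d| < 2 * pi -> d = 0.
Proof.
move=> sd cd; rewrite ltr_norml => /andP[d1 d2].
have dE : d = (d / 2) *+ 2 by rewrite -mulr_natr divfK.
move: sd cd; rewrite dE sin_mulr2n cos_mulr2n => /eqP.
rewrite mulrn_eq0/= mulf_eq0 => /orP[/eqP->|/eqP s0 _].
  by rewrite expr0n/= mul0rn sub0r oppr_gt0 ltNge ler01.
have [dp|dn|d0] := ltgtP 0 (d / 2); last by rewrite -d0 mul0rn.
  have : 0 < sin (d / 2) by apply: sin_gt0_pi; apply/andP; split; lra.
  by rewrite s0 ltxx.
have : 0 < sin (- (d / 2)) by apply: sin_gt0_pi; apply/andP; split; lra.
by rewrite sinN s0 oppr0 ltxx.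
Qed.

(* Strictly decreasing, at least 1 on the negative half-line. *)
Definition level (phi : R) : R := 1 - atan phi / 4.

Lemma level_gt0 phi : 0 < level phi.
Proof. by have := atan_ltpi2 phi; have := pihalf_lt2 R; rewrite /level; lra. Qed.

(** As [bump] is below 1, the coil uses positive angles only, as [sigma_sep] requires. *)
Lemma level_lt1 phi : level phi < 1 -> 0 < phi.
Proof.
have [//|p0] := ltP 0 phi; have := le_atan p0; rewrite atan0 /level; lra.
Qed.

Lemma level_lip a b : `|level a - level b| <= `|a - b|.
Proof.
have -> : level a - level b = - ((atan a - atan b) / 4) by rewrite /level; field.
rewrite normrN normrM normfV normr_nat.
by have := atan_lip a b; have := normr_ge0 (a - b); lra.
Qed.

Lemma is_derive_level (phi : R) :
  is_derive phi 1 level (- ((1 + phi ^+ 2)^-1 / 4)).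
Proof.
have H := is_deriveB (is_derive_cst (1 : R) phi (1 : R)) (is_deriveZ (4^-1) (is_derive1_atan phi)).
apply: near_eq_is_derive (is_derive_eq H _).
  by apply: filterE => x; rewrite /level !fctE /GRing.scale/= mulrC.
by rewrite sub0r mulrC.
Qed.

Lemma level_lt a b : a < b -> level b < level a.
Proof. by move=> /lt_atan; rewrite /level; lra. Qed.

Lemma Ck_level k (phi : R) : Ck k level phi.
Proof.
apply: Ck_sub; first exact: Ck_cst.
by apply: Ck_mul; [exact: Ck_atan|exact: Ck_cst].
Qed.

End RealLipschitz.

(** * The coil function in polar coordinates *)

Section Tube.
Context {R : realType} {X : normedModType R}.
Context (xi1 xi2 : X -> R) (u1 u2 : X) (e : nat -> X) (zeta : nat -> X -> R).
Context (c1 : contractive_form xi1) (c2 : contractive_form xi2).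
Context (x11 : xi1 u1 = 1) (x12 : xi1 u2 = 0) (x21 : xi2 u1 = 0) (x22 : xi2 u2 = 1).
Context (u1n : `|u1| <= 2) (u2n : `|u2| <= 1).
Context (e1 : forall i, xi1 (e i) = 0) (e2 : forall i, xi2 (e i) = 0).
Context (en : forall i, `|e i| <= 1)
  (cz : forall i, contractive_form (zeta i)) (ze : forall i, zeta i (e i) = 1)
  (zk : forall j n, (j < n)%N -> zeta j (e n) = 0).
Context (bump : X -> R) (r : R) (r0 : 0 <= r) (bump_lt1 : forall x, bump x < 1) (bump_supp : forall x, bump x != 0 -> `|x| <= r)
  (bump_at0 : bump 0 = 9 / 10).

(** Since [r / kappa < 1/4], the squared radius stays within 1/4 of 1 in the coil, away from the
    axis. Then [rad] bounds the distance from [zpart x] to the drift, as [|u1| <= 2]. Finally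
    [gap / 4 = 2 * rad + 2] exceeds [2 * rad + 1], the largest drift distance compatible with two
    coil points whose [zpart] are within 1. *)
Definition kappa : R := 4 * r + 1.
Definition rad : R := r + kappa / 2.
Definition gap : R := 4 * (2 * rad + 2).
Definition drift : R -> X := sigma e gap.
Definition rho2 (x : X) : R := xi1 x * xi1 x + xi2 x * xi2 x.
Definition zpart (x : X) : X := x - xi1 x *: u1 - xi2 x *: u2.
(** Follows a winding back to the origin. The squared radius, unlike the radius, is polynomial in
    the coordinates. *)
Definition Phi (x : X) (phi : R) : X := zpart x + (kappa * (rho2 x - 1)) *: u1 - drift phi.
Definition tube_val (x : X) (phi : R) : R := flat 0 (bump (Phi x phi) - level phi).
(** [radial] and [transversal] are the planar coordinates in the frame rotated by [phi]. *)
Definition radial (phi : R) (x : X) : R := xi1 x * cos phi + xi2 x * sin phi.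
Definition transversal (phi : R) (x : X) : R := xi2 x * cos phi - xi1 x * sin phi.
Definition is_angle (x : X) (phi : R) : Prop := transversal phi x = 0 /\ 0 < radial phi x.
(** The branch of the polar angle with values within [pi / 2] of [phi], smooth on the half-space
    where [radial phi] is positive. *)
Definition angle_near (phi : R) (x : X) : R := phi + atan (transversal phi x / radial phi x).

Lemma kappa_gt0 : 0 < kappa. Proof. by have h := r0; rewrite /kappa; lra. Qed.
Lemma gap_ge0 : 0 <= gap.
Proof. by have k0 := kappa_gt0; have h := r0; rewrite /gap /rad; lra. Qed.

Lemma radial_shift phi t x : radial (phi + t) x = radial phi x * cos t + transversal phi x * sin t.
Proof. by rewrite /radial /transversal cosD sinD; ring. Qed.

Lemma transversal_shift phi t x : transversal (phi + t) x = transversal phi x * cos t - radial phi x * sin t.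
Proof. by rewrite /radial /transversal cosD sinD; ring. Qed.

Lemma radial_transversal_sq phi x : radial phi x * radial phi x + transversal phi x * transversal phi x = rho2 x.
Proof.
rewrite /radial /transversal /rho2; have := cos2Dsin2 phi; rewrite !expr2 => E.
have -> : (xi1 x * cos phi + xi2 x * sin phi) * (xi1 x * cos phi + xi2 x * sin phi) +
  (xi2 x * cos phi - xi1 x * sin phi) * (xi2 x * cos phi - xi1 x * sin phi) =
  (xi1 x * xi1 x + xi2 x * xi2 x) * (cos phi * cos phi + sin phi * sin phi) by ring.
by rewrite E mulr1.
Qed.

Lemma is_angle_xi x phi : is_angle x phi ->
  xi1 x = radial phi x * cos phi /\ xi2 x = radial phi x * sin phi.
Proof.
move=> [b0 _]; have := cos2Dsin2 phi; rewrite !expr2 => E.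
have h1 : xi1 x = radial phi x * cos phi - transversal phi x * sin phi.
  have -> : radial phi x * cos phi - transversal phi x * sin phi =
    xi1 x * (cos phi * cos phi + sin phi * sin phi) by rewrite /radial /transversal; ring.
  by rewrite E mulr1.
have h2 : xi2 x = radial phi x * sin phi + transversal phi x * cos phi.
  have -> : radial phi x * sin phi + transversal phi x * cos phi =
    xi2 x * (cos phi * cos phi + sin phi * sin phi) by rewrite /radial /transversal; ring.
  by rewrite E mulr1.
by move: h1 h2; rewrite b0 !mul0r subr0 addr0.
Qed.

Lemma is_angle_angle_near phi x : 0 < radial phi x -> is_angle x (angle_near phi x).
Proof.
move=> a0; rewrite /is_angle /angle_near radial_shift transversal_shift; set t := transversal phi x / radial phi x.
have ct : 0 < cos (atan t).
  by apply: cos_gt0_pihalf; rewrite atan_gtNpi2 atan_ltpi2.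
have st : sin (atan t) = t * cos (atan t).
  by rewrite -[X in _ = X * _]atanK /tan divfK// gt_eqF.
have bE : transversal phi x = radial phi x * t by rewrite mulrC /t divfK// gt_eqF.
split; first by rewrite st bE; ring.
rewrite st bE; have -> : radial phi x * cos (atan t) + radial phi x * t * (t * cos (atan t))
  = radial phi x * cos (atan t) * (1 + t * t) by ring.
by rewrite !mulr_gt0// ltr_wpDr// -expr2 sqr_ge0.
Qed.

Lemma is_angle_unique x phi psi : is_angle x phi -> is_angle x psi -> `|psi - phi| < 2 * pi -> psi = phi.
Proof.
move=> [b0 a0] [b1 a1] /sin0_cos_gt0 E; apply/eqP; rewrite -subr_eq0; apply/eqP; apply: E.
  move: b1; rewrite -{1}[psi](subrK phi) addrC transversal_shift b0 mul0r sub0r => /eqP.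
  by rewrite oppr_eq0 mulf_eq0 gt_eqF//= => /eqP.
by move: a1; rewrite -{1}[psi](subrK phi) addrC radial_shift b0 mul0r addr0 pmulr_rgt0.
Qed.

Lemma angle_near_lt_pihalf phi x : `|angle_near phi x - phi| < pi / 2.
Proof. by rewrite /angle_near addrAC subrr add0r ltr_norml atan_ltpi2 atan_gtNpi2. Qed.

Lemma angle_near_lt2 phi x : `|angle_near phi x - phi| < 2.
Proof. exact: lt_trans (angle_near_lt_pihalf phi x) (pihalf_lt2 R). Qed.

Lemma zpartB x y : zpart x - zpart y = zpart (x - y).
Proof.
have B (a b c d : X) : (a - b) - (c - d) = (a - c) - (b - d).
  by rewrite !opprB addrACA [RHS]addrACA [- b - c]addrC.
rewrite /zpart (contractive_formB _ _ c1) (contractive_formB _ _ c2) !scalerBl B; congr (_ - _); exact: B.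
Qed.

Lemma xi1_zpart x : xi1 (zpart x) = 0.
Proof.
by rewrite /zpart !(contractive_formB _ _ c1) !(contractive_formZ _ _ c1) x11 x12; ring.
Qed.

Lemma xi2_zpart x : xi2 (zpart x) = 0.
Proof.
by rewrite /zpart !(contractive_formB _ _ c2) !(contractive_formZ _ _ c2) x21 x22; ring.
Qed.

Lemma xi1_drift phi : xi1 (drift phi) = 0.
Proof. exact: (sigma_ker _ _ c1 e1). Qed.

Lemma xi2_drift phi : xi2 (drift phi) = 0.
Proof. exact: (sigma_ker _ _ c2 e2). Qed.

Lemma zpart_le x : `|zpart x| <= 4 * `|x|.
Proof.
rewrite /zpart; have := ler_normB (x - xi1 x *: u1) (xi2 x *: u2).
have := ler_normB x (xi1 x *: u1); rewrite !normrZ.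
have := ler_pM (normr_ge0 _) (normr_ge0 _) (c1.2 x) u1n.
have := ler_pM (normr_ge0 _) (normr_ge0 _) (c2.2 x) u2n.
lra.
Qed.

Lemma tube_val_neq0 x phi : tube_val x phi != 0 -> 0 < bump (Phi x phi) - level phi.
Proof. by move=> h; rewrite ltNge; apply/negP => /(flat_le0 0)/eqP; apply/negP. Qed.

Lemma tube_val_angle_gt0 x phi : tube_val x phi != 0 -> 0 < phi.
Proof.
by move=> /tube_val_neq0 h; apply: level_lt1; have := bump_lt1 (Phi x phi); lra.
Qed.

Lemma tube_val_ball x phi : tube_val x phi != 0 -> `|Phi x phi| <= r.
Proof.
move=> /tube_val_neq0 h; apply: bump_supp; rewrite gt_eqF//.
by have := level_gt0 phi; lra.
Qed.

(** Apply [xi1] to [Phi x phi]: [zpart] and the drift lie in its kernel, so only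
    [kappa * (rho2 x - 1)] is left, and it is at most [r] in absolute value. *)
Lemma tube_val_rho2 x phi : tube_val x phi != 0 -> `|rho2 x - 1| <= 1 / 4.
Proof.
move=> /tube_val_ball h; have k0 := kappa_gt0.
have := le_trans (c1.2 _) h; rewrite /Phi (contractive_formB _ _ c1) (contractive_formD _ _ c1).
rewrite (contractive_formZ _ _ c1) xi1_zpart xi1_drift x11 add0r subr0 mulr1 normrM (gtr0_norm k0).
move=> h'; rewrite -(ler_pM2l k0); apply: le_trans h' _; rewrite /kappa; lra.
Qed.

Lemma tube_val_zpart x phi : tube_val x phi != 0 -> `|zpart x - drift phi| <= rad.
Proof.
move=> Hx; have h1 := tube_val_ball Hx; have h2 := tube_val_rho2 Hx; have k0 := kappa_gt0.
have -> : zpart x - drift phi = Phi x phi - (kappa * (rho2 x - 1)) *: u1.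
  by rewrite /Phi [RHS]addrAC addrK.
apply: le_trans (ler_normB _ _) _; rewrite normrZ normrM (gtr0_norm k0) /rad.
have h3 : kappa * `|rho2 x - 1| <= kappa * (1 / 4) by rewrite ler_pM2l.
have := ler_pM (mulr_ge0 (ltW k0) (normr_ge0 _)) (normr_ge0 _) h3 u1n; lra.
Qed.

(** The separation of windings: parameters at distance 2 or more would have drifts at least
    [2 * rad + 2] apart, although each drift is within [rad] of its [zpart]. As 2 is less than
    [2 * pi], one point cannot lie on two windings. *)
Lemma tube_val_angles_close x y phi psi : tube_val x phi != 0 -> tube_val y psi != 0 ->
  `|zpart x - zpart y| <= 1 -> `|psi - phi| < 2.
Proof.
move=> Hx Hy xy.
have h : `|drift phi - drift psi| <= 2 * rad + 1.
  have -> : drift phi - drift psi = (zpart x - zpart y) - (zpart x - drift phi) + (zpart y - drift psi).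
    have T (a b s t : X) : s - t = (a - b) - (a - s) + (b - t).
      by rewrite opprB [a - b + _]addrC !subrKA.
    exact: T.
  have := ler_normD (zpart x - zpart y - (zpart x - drift phi)) (zpart y - drift psi).
  have := ler_normB (zpart x - zpart y) (zpart x - drift phi).
  by have := tube_val_zpart Hx; have := tube_val_zpart Hy; lra.
have sep a b : 0 < a -> a + 2 <= b -> 2 * rad + 2 <= `|drift a - drift b|.
  move=> a0 ab; have := sigma_sep gap_ge0 en cz ze zk (ltW a0) ab.
  by rewrite -/drift /gap; lra.
rewrite ltNge; apply/negP; rewrite ler_normr => /orP[ge2|ge2].
  by have := @sep phi psi (tube_val_angle_gt0 Hx); lra.
by have := @sep psi phi (tube_val_angle_gt0 Hy); rewrite distrC; lra.
Qed.

(* If no angle qualifies, [get] returns 0, where [tube_val x] vanishes. *)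
Definition tube_fun (x : X) : R :=
  tube_val x (get [set phi | is_angle x phi /\ tube_val x phi != 0]).

Lemma tube_fun0 x : (forall phi, is_angle x phi -> tube_val x phi = 0) -> tube_fun x = 0.
Proof.
move=> H0; apply: contrapT => /eqP; rewrite /tube_fun.
case: xgetP => [phi _ [/H0->]|_]; first by rewrite eqxx.
by move=> /tube_val_angle_gt0; rewrite ltxx.
Qed.

Lemma tube_funE x phi : is_angle x phi -> tube_val x phi != 0 -> tube_fun x = tube_val x phi.
Proof.
move=> A Hx; rewrite /tube_fun; set psi := get _.
have [A' Hx'] : [set phi | is_angle x phi /\ tube_val x phi != 0] psi by exact: (@getPex _ _ (ex_intro _ phi _)).
congr (tube_val x _); apply: is_angle_unique A A' _.
have := @tube_val_angles_close x x phi psi Hx Hx'; rewrite subrr normr0 => /(_ ler01).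
have := pi_ge2 R; lra.
Qed.

Lemma tube_fun_angle x : tube_fun x != 0 ->
  exists phi, [/\ is_angle x phi, tube_val x phi != 0 & tube_fun x = tube_val x phi].
Proof.
move=> fx; apply: contrapT => nex; move/eqP: fx; apply.
apply: tube_fun0 => phi A; apply: contrapT => /eqP Hx; apply: nex.
by exists phi; split=> //; exact: tube_funE.
Qed.

(** Any qualifying angle of [y] is within 2 of [phi], and so is [angle_near phi y]; two angles of
    [y] that differ by less than [4 <= 2 * pi] are equal. *)
Lemma tube_fun_angle_near x y phi : is_angle x phi -> tube_val x phi != 0 ->
  `|zpart x - zpart y| <= 1 -> 0 < radial phi y -> tube_fun y = tube_val y (angle_near phi y).
Proof.
move=> A Hx xy a0; have Al := is_angle_angle_near a0.
have [Hy|Hy] := eqVneq (tube_val y (angle_near phi y)) 0; last exact: tube_funE.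
rewrite Hy; apply: tube_fun0 => psi Apsi; apply: contrapT => /eqP Hpsi.
have h1 := tube_val_angles_close Hx Hpsi xy; have h2 := angle_near_lt2 phi y.
suff E : psi = angle_near phi y by move: Hpsi; rewrite E Hy eqxx.
apply: is_angle_unique Al Apsi _.
have := ler_normD (psi - phi) (phi - angle_near phi y); rewrite subrKA (distrC phi).
by have := pi_ge2 R; lra.
Qed.

Lemma radial_lip phi x y : `|radial phi x - radial phi y| <= 2 * `|x - y|.
Proof.
have -> : radial phi x - radial phi y = xi1 (x - y) * cos phi + xi2 (x - y) * sin phi.
  by rewrite /radial (contractive_formB _ _ c1) (contractive_formB _ _ c2); ring.
apply: le_trans (ler_normD _ _) _; rewrite !normrM.
have hc : `|cos phi| <= 1 by rewrite ler_norml cos_geN1 cos_le1.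
have hs : `|sin phi| <= 1 by rewrite ler_norml sin_geN1 sin_le1.
have := ler_pM (normr_ge0 _) (normr_ge0 _) (c1.2 (x - y)) hc.
have := ler_pM (normr_ge0 _) (normr_ge0 _) (c2.2 (x - y)) hs; lra.
Qed.

Lemma transversal_lip phi x y : `|transversal phi x - transversal phi y| <= 2 * `|x - y|.
Proof.
have -> : transversal phi x - transversal phi y = xi2 (x - y) * cos phi - xi1 (x - y) * sin phi.
  by rewrite /transversal (contractive_formB _ _ c1) (contractive_formB _ _ c2); ring.
apply: le_trans (ler_normB _ _) _; rewrite !normrM.
have hc : `|cos phi| <= 1 by rewrite ler_norml cos_geN1 cos_le1.
have hs : `|sin phi| <= 1 by rewrite ler_norml sin_geN1 sin_le1.
have := ler_pM (normr_ge0 _) (normr_ge0 _) (c2.2 (x - y)) hc.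
have := ler_pM (normr_ge0 _) (normr_ge0 _) (c1.2 (x - y)) hs; lra.
Qed.

Lemma near_zpart x : \forall y \near x, `|zpart x - zpart y| <= 1.
Proof.
near=> y; rewrite zpartB; apply: le_trans (zpart_le _) _; rewrite distrC.
have : `|y - x| <= 1 / 4 by near: y; apply: near_le1; lra.
lra.
Unshelve. all: by end_near. Qed.

Lemma near_radial phi x (a : R) : a < radial phi x -> \forall y \near x, a < radial phi y.
Proof.
move=> a0; near=> y; have h1 := radial_lip phi x y; have h2 := ler_norm (radial phi x - radial phi y).
have h3 : `|y - x| <= (radial phi x - a) / 4 by near: y; apply: near_le1; lra.
rewrite distrC in h3; lra.
Unshelve. all: by end_near. Qed.

(** [x0] itself need not be in the coil. Near the axis the function is 0. Elsewhere take a small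
    ball: either the function is 0 on it, or some point of the ball is in the coil and its angle
    gives a branch valid on the whole ball. This covers points on the edge of the coil too. *)
Lemma tube_fun_local (x0 : X) : (\forall x \near x0, tube_fun x = 0) \/
  exists phi, \forall x \near x0, 0 < radial phi x /\ tube_fun x = tube_val x (angle_near phi x).
Proof.
have [rho0|rho0] := eqVneq (rho2 x0) 0.
  left; have [x10 x20] : xi1 x0 = 0 /\ xi2 x0 = 0.
    move: rho0; rewrite /rho2 -!expr2 => /eqP; rewrite paddr_eq0 ?sqr_ge0// !sqrf_eq0.
    by move=> /andP[/eqP-> /eqP->].
  near=> x; apply: tube_fun0 => phi _; apply: contrapT => /eqP/tube_val_rho2.
  have xx : `|x - x0| <= 1 / 4 by near: x; apply: near_le1; lra.
  have := c1.2 (x - x0); have := c2.2 (x - x0).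
  rewrite (contractive_formB _ _ c1) (contractive_formB _ _ c2) x10 x20 !subr0 => h2 h1.
  have q1 : `|xi1 x| * `|xi1 x| <= 1 / 16.
    by have := normr_ge0 (xi1 x); nra.
  have q2 : `|xi2 x| * `|xi2 x| <= 1 / 16.
    by have := normr_ge0 (xi2 x); nra.
  rewrite -!normrM in q1 q2; have := ler_norm (xi1 x * xi1 x); have := ler_norm (xi2 x * xi2 x).
  by rewrite /rho2 ler_norml; lra.
pose dot (x y : X) := xi1 x * xi1 y + xi2 x * xi2 y.
have rho1 : 0 < rho2 x0 by rewrite lt_def rho0 /rho2 -!expr2 addr_ge0 ?sqr_ge0.
(* The planar parts of any two points near [x0] make an acute angle. *)
have [d [d0 dP]] : exists d, 0 < d /\ forall x y, `|x - x0| < d -> `|y - x0| < d ->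
   `|zpart x - zpart y| <= 1 /\ 0 < dot x y.
  pose M := `|x0| + 1.
  have M0 : 0 < M by rewrite /M ltr_wpDl.
  (* 1/8 serves [zpart], which is 4-Lipschitz on a ball of diameter [2 * d]. Each coordinate of
     [dot] loses at most [3 * d * M], and [6 * d * M < rho2 x0]. *)
  pose d := Num.min (1 / 8) (rho2 x0 / (8 * M)).
  have d0 : 0 < d by rewrite lt_min divr_gt0//= divr_gt0// mulr_gt0.
  have d1 : d <= 1 / 8 by rewrite /d ge_min lexx.
  have d2 : d * (8 * M) <= rho2 x0.
    by rewrite -ler_pdivlMr ?mulr_gt0// /d ge_min lexx orbT.
  exists d; split=> // x y xd yd; split.
    rewrite zpartB; apply: le_trans (zpart_le _) _.
    have := ler_normD (x - x0) (x0 - y); rewrite subrKA (distrC x0 y); lra.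
  have pr (xi : X -> R) : contractive_form xi ->
      xi x0 * xi x0 - d * (3 * M) <= xi x * xi y.
    move=> cxi; have := cxi.2 (x - x0); have := cxi.2 (y - x0); have := cxi.2 x0.
    rewrite !(contractive_formB _ _ cxi).
    move: (xi x) (xi y) (xi x0) => a b c hc hb ha.
    have ha' : `|a - c| <= d by apply: le_trans ha (ltW xd).
    have hb' : `|b - c| <= d by apply: le_trans hb (ltW yd).
    have hc' : `|c| <= M by rewrite /M; apply: le_trans hc _; rewrite lerDl.
    have -> : a * b = c * c + (a - c) * c + c * (b - c) + (a - c) * (b - c) by ring.
    have p1 := ler_pM (normr_ge0 _) (normr_ge0 _) ha' hc'.
    have p2 := ler_pM (normr_ge0 _) (normr_ge0 _) hc' hb'.
    have p3 := ler_pM (normr_ge0 _) (normr_ge0 _) ha' hb'.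
    rewrite -!normrM in p1 p2 p3.
    have := ler_norm (- ((a - c) * c)); have := ler_norm (- (c * (b - c))).
    have := ler_norm (- ((a - c) * (b - c))); rewrite !normrN.
    have dM : d * d <= d * M.
      apply: ler_wpM2l; first exact: ltW.
      by have := normr_ge0 x0; rewrite /M; lra.
    lra.
  have := pr _ c1; have := pr _ c2; move: d2; rewrite /dot /rho2.
  by have := mulr_gt0 d0 M0; lra.
have nd : \forall x \near x0, `|x - x0| < d.
  by apply/nbhs_normP; exists d => //= y; rewrite /= distrC.
have [allz|] := pselect (forall x, `|x - x0| < d -> tube_fun x = 0).
  by left; apply: filterS nd.
move=> /existsNP[x /not_implyP[xd /eqP fx]].
have [phi [A Hx _]] := tube_fun_angle fx.
right; exists phi; apply: filterS nd => y yd.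
have [zxy dxy] := dP x y xd yd.
have ay : 0 < radial phi y.
  have [h1 h2] := is_angle_xi A.
  (* Since [phi] is an angle of [x], this product is the planar inner product of [x] and [y]. *)
  have : 0 < radial phi x * radial phi y.
    suff -> : radial phi x * radial phi y = dot x y by [].
    by rewrite /dot h1 h2 [radial phi y]/radial; ring.
  by rewrite pmulr_rgt0//; case: A.
by split=> //; exact: tube_fun_angle_near A Hx zxy ay.
Unshelve. all: by end_near. Qed.

Lemma Ck_xi1 k x : Ck k xi1 x.
Proof. by apply: (@Ck_linear _ _ k xi1 1 x ler01 c1.1) => h; rewrite mul1r; exact: c1.2. Qed.

Lemma Ck_xi2 k x : Ck k xi2 x.
Proof. by apply: (@Ck_linear _ _ k xi2 1 x ler01 c2.1) => h; rewrite mul1r; exact: c2.2. Qed.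

Lemma Ck_angle_near k phi x : 0 < radial phi x -> Ck k (angle_near phi) x.
Proof.
move=> a0; have Ca : Ck k (radial phi) x.
  by apply: Ck_add; apply: Ck_mul; (exact: Ck_cst || exact: Ck_xi1 || exact: Ck_xi2).
have Cb : Ck k (transversal phi) x.
  by apply: Ck_sub; apply: Ck_mul; (exact: Ck_cst || exact: Ck_xi1 || exact: Ck_xi2).
apply: Ck_add; first exact: Ck_cst.
apply: (@Ck_comp _ _ _ atan (fun y => transversal phi y / radial phi y)); first exact: Ck_atan.
apply: Ck_mul => //; apply: (@Ck_comp _ _ _ (fun t : R => t^-1) (radial phi)) => //.
by apply: Ck_inv; rewrite gt_eqF.
Qed.

Lemma Ck_bump_Phi k phi x : (forall y, Ck k bump y) -> 0 < radial phi x ->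
  Ck k (fun y => bump (Phi y (angle_near phi y))) x.
Proof.
move=> Cbt a0.
(* The branch stays below [phi + 2], so [N] terms give the drift on all of it, and [Phi] takes the
   form that [Ck_family_comp] expects. *)
pose N := (Num.truncn (phi + 2)).+2.
pose g (i : nat) (y : X) : R :=
  match i with
  | 0 => kappa * (rho2 y - 1) - xi1 y
  | 1 => - xi2 y
  | i.+2 => - (gap * omega (angle_near phi y - i%:R))
  end.
pose u (i : nat) : X := match i with 0 => u1 | 1 => u2 | i.+2 => e i end.
have E y : Phi y (angle_near phi y) = id y + \sum_(i < N.+2) g i y *: u i.
  rewrite 2!big_ord_recl (eq_bigr (fun i : 'I_N => - ((gap * omega (angle_near phi y - i%:R)) *: e i))); last first.
    by move=> i _; rewrite /= scaleNr.
  rewrite sumrN -/(sig e gap N (angle_near phi y)) /= /Phi /drift (@sigmaE _ _ _ _ N); last first.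
    have := angle_near_lt2 phi y; rewrite ltr_norml => /andP[_].
    by have := truncn_lt (phi + 2); rewrite /N -(addn1 (Num.truncn _).+1) natrD; lra.
  rewrite /zpart scalerBl scaleNr !addrA; congr (_ - _).
  by rewrite [LHS]addrAC; congr (_ + _); exact: addrAC.
apply: (@Ck_near _ _ _ (fun y => bump (id y + \sum_(i < N.+2) g i y *: u i))).
  by apply: nearW => y; rewrite E.
apply: (@Ck_family_comp _ _ _ k N.+2 _ w1 (fun y _ => bump y) id (fun i => g i) (fun i => u i) x 1) => //.
- by move=> h; rewrite mul1r.
- case=> [[|[|i]]] /= _.
  + apply: Ck_sub; last exact: Ck_xi1.
    apply: Ck_mul; first exact: Ck_cst.
    apply: Ck_sub; last exact: Ck_cst.
    by apply: Ck_add; apply: Ck_mul; (exact: Ck_xi1 || exact: Ck_xi2).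
  + by apply: Ck_opp; exact: Ck_xi2.
  apply: Ck_opp; apply: Ck_mul; first exact: Ck_cst.
  apply: (@Ck_comp _ _ _ omega (fun y => angle_near phi y - i%:R)); first exact: Ck_omega.
  by apply: Ck_sub; [exact: Ck_angle_near|exact: Ck_cst].
exact: Cbt.
Qed.

Lemma Ck_tube_arg k phi x : (forall y, Ck k bump y) -> 0 < radial phi x ->
  Ck k (fun y => bump (Phi y (angle_near phi y)) - level (angle_near phi y)) x.
Proof.
move=> Cbt a0; apply: Ck_sub; first exact: Ck_bump_Phi.
by apply: (@Ck_comp _ _ _ level (angle_near phi)); [exact: Ck_level|exact: Ck_angle_near].
Qed.

Lemma Ck_tube_fun k x : (forall y, Ck k bump y) -> Ck k tube_fun x.
Proof.
move=> Cbt; have [f0|[phi f1]] := tube_fun_local x.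
  apply: (@Ck_near _ _ _ (fun=> 0)); last exact: Ck_cst.
  by apply: filterS f0 => y ->.
have [a0 _] := nbhs_singleton f1.
apply: (@Ck_near _ _ _ (fun y => flat 0 (bump (Phi y (angle_near phi y)) - level (angle_near phi y)))).
  by apply: filterS f1 => y [_ ->].
by apply: (@Ck_comp _ _ _ (flat 0)); [exact: Ck_flat|exact: Ck_tube_arg].
Qed.

(** Rotates the planar part at constant radius while [zpart] follows the drift. It starts at [x]
    only if [phi] is an angle of [x]. *)
Definition flow (x : X) (phi s : R) : X :=
  zpart x + (radial phi x * cos (phi + s)) *: u1 + (radial phi x * sin (phi + s)) *: u2
  + (drift (phi + s) - drift phi).

Lemma flow0 x phi : is_angle x phi -> flow x phi 0 = x.
Proof.
move=> /is_angle_xi[h1 h2]; rewrite /flow addr0 -h1 -h2 subrr addr0 /zpart.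
by move: (_ *: u1) (_ *: u2) => p q; rewrite [x - p - q + p]addrAC !subrK.
Qed.

Lemma xi1_flow x phi s : xi1 (flow x phi s) = radial phi x * cos (phi + s).
Proof.
have T z a b t : xi1 (z + a *: u1 + b *: u2 + t) = xi1 z + a + xi1 t.
  rewrite !(contractive_formD _ _ c1) !(contractive_formZ _ _ c1) x11 x12; ring.
by rewrite /flow T xi1_zpart (contractive_formB (drift _) (drift _) c1) !xi1_drift; ring.
Qed.

Lemma xi2_flow x phi s : xi2 (flow x phi s) = radial phi x * sin (phi + s).
Proof.
have T z a b t : xi2 (z + a *: u1 + b *: u2 + t) = xi2 z + b + xi2 t.
  rewrite !(contractive_formD _ _ c2) !(contractive_formZ _ _ c2) x21 x22; ring.
by rewrite /flow T xi2_zpart (contractive_formB (drift _) (drift _) c2) !xi2_drift; ring.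
Qed.

Lemma is_angle_flow x phi s : 0 < radial phi x -> is_angle (flow x phi s) (phi + s).
Proof.
move=> a0; have := cos2Dsin2 (phi + s); rewrite !expr2 => E.
rewrite /is_angle {1}/transversal {1}/radial xi1_flow xi2_flow; split; first by ring.
have -> : radial phi x * cos (phi + s) * cos (phi + s) + radial phi x * sin (phi + s) * sin (phi + s) =
  radial phi x * (cos (phi + s) * cos (phi + s) + sin (phi + s) * sin (phi + s)) by ring.
by rewrite E mulr1.
Qed.

Lemma Phi_flow x phi s : is_angle x phi -> Phi (flow x phi s) (phi + s) = Phi x phi.
Proof.
move=> [b0 _]; have := cos2Dsin2 (phi + s); rewrite !expr2 => E.
have -> : Phi (flow x phi s) (phi + s) =
    zpart (flow x phi s) + (kappa * (rho2 (flow x phi s) - 1)) *: u1 - drift (phi + s) by [].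
have -> : rho2 (flow x phi s) = rho2 x.
  rewrite -(radial_transversal_sq phi x) b0 mul0r addr0 /rho2 xi1_flow xi2_flow.
  by rewrite -[RHS]mulr1 -E; ring.
have -> : zpart (flow x phi s) = zpart x + (drift (phi + s) - drift phi).
  rewrite {1}/zpart xi1_flow xi2_flow /flow.
  move: (zpart x) (_ *: u1) (_ *: u2) (drift _ - _) => z p q t.
  by rewrite addrAC [z + p + q + t]addrAC addrK [z + p + t]addrAC addrK.
rewrite /Phi; move: (zpart x) (_ *: u1) (drift phi) (drift (phi + s)) => z p t t'.
by rewrite [z + _ + p]addrAC -[LHS]addrA [X in _ + X = _]addrAC subrr sub0r.
Qed.

Definition drift_const : R := gap * (8 * expR 2) * 4.

Lemma drift_const_ge0 : 0 <= drift_const.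
Proof. by have h := mulr_ge0 gap_ge0 (expR_ge0 (2 : R)); rewrite /drift_const; lra. Qed.

Lemma drift_lip phi psi : `|psi - phi| <= 1 ->
  `|drift psi - drift phi| <= drift_const * `|psi - phi|.
Proof. by move=> h; have := sigma_lip gap_ge0 en h. Qed.

Lemma tube_fun_flow x phi s : is_angle x phi -> level (phi + s) < bump (Phi x phi) ->
  tube_fun (flow x phi s) = flat 0 (bump (Phi x phi) - level (phi + s)).
Proof.
move=> A lt; have A' := is_angle_flow s A.2.
have HE : tube_val (flow x phi s) (phi + s) = flat 0 (bump (Phi x phi) - level (phi + s)).
  by rewrite /tube_val Phi_flow.
by rewrite -HE; apply: tube_funE => //; rewrite HE gt_eqF// flat_gt0// subr_gt0.
Qed.

Lemma flow_lip x phi : is_angle x phi -> exists2 C, 0 <= C & forall s,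
  `|s| <= 1 -> `|flow x phi s - x| <= C * `|s|.
Proof.
move=> A; have a0 := A.2; have L0 := drift_const_ge0.
exists (3 * radial phi x + drift_const) => [|s s1]; first by rewrite addr_ge0// mulr_ge0// ltW.
have hsg : `|drift (phi + s) - drift phi| <= drift_const * `|s|.
  by have := @drift_lip phi (phi + s); rewrite addrAC subrr add0r; apply.
have -> : flow x phi s - x = (radial phi x * (cos (phi + s) - cos phi)) *: u1
   + (radial phi x * (sin (phi + s) - sin phi)) *: u2 + (drift (phi + s) - drift phi).
  rewrite -[X in _ - X](flow0 A) /flow addr0 subrr addr0 !mulrBr !scalerBl.
  move: (zpart x) (_ *: u1) (_ *: u1) (_ *: u2) (_ *: u2) (drift _ - _) => z p p' q q' t.
  rewrite addrAC; congr (_ + _); rewrite opprD addrACA; congr (_ + _).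
  by rewrite opprD addrACA subrr add0r.
have hc : `|cos (phi + s) - cos phi| <= `|s|.
  by apply: le_trans (cos_lip _ _) _; rewrite addrAC subrr add0r.
have hn : `|sin (phi + s) - sin phi| <= `|s|.
  by apply: le_trans (sin_lip _ _) _; rewrite addrAC subrr add0r.
apply: le_trans (ler_normD _ _) _; rewrite [leRHS]mulrDl; apply: lerD => //.
apply: le_trans (ler_normD _ _) _; rewrite !normrZ ?normrM (gtr0_norm a0).
have k1 := ler_pM (mulr_ge0 (ltW a0) (normr_ge0 _)) (normr_ge0 _)
   (ler_wpM2l (ltW a0) hc) u1n.
have k2 := ler_pM (mulr_ge0 (ltW a0) (normr_ge0 _)) (normr_ge0 _)
   (ler_wpM2l (ltW a0) hn) u2n.
lra.
Qed.

Lemma flow_lip_near x phi : is_angle x phi -> exists2 C, 0 <= C &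
  \forall s \near (0 : R), `|flow x phi s - flow x phi 0| <= C * `|s - 0|.
Proof.
move=> A; have [C C0 flip] := flow_lip A; exists C => //.
near=> s; rewrite (flow0 A) subr0; apply: flip.
rewrite -[s]subr0; near: s. exact: (@near_le1 R R 0 1 ltr01).
Unshelve. all: by end_near. Qed.

(* Along the flow, [Phi] is constant and [level] decreases at a positive rate. *)
Lemma tube_fun_der_neq0 x L : tube_fun x != 0 ->
  fder w1 (fun y _ => tube_fun y) x L -> exists h, L (tt, h) != 0.
Proof.
(* If the derivative vanished, [tube_fun] would change by [o(s)] along the flow, because the flow is
   Lipschitz at 0; no tangent vector is needed. But there it equals [G s], with [G' (0) = d > 0]. *)
move=> fx [_ _ estL]; apply: contrapT => /forallNP L0.
have {}L0 h : L (tt, h) = 0 by apply: contrapT => /eqP; exact: L0.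
have [phi [A Hx fE]] := tube_fun_angle fx.
have p0 := tube_val_angle_gt0 Hx; have A0 := tube_val_neq0 Hx.
set a := bump (Phi x phi) in A0 fE.
pose G s := flat 0 (a - level (phi + s)).
pose d := flat 2 (a - level phi) * ((1 + phi ^+ 2)^-1 / 4).
have d0 : 0 < d.
  by rewrite mulr_gt0 ?flat_gt0// divr_gt0// invr_gt0 ltr_wpDr// sqr_ge0.
have dG : is_derive (0 : R) (1 : R) G d.
  have h1 : is_derive (0 : R) (1 : R) (fun s => phi + s) 1.
    apply: is_derive_eq (is_deriveD (is_derive_cst phi (0 : R) (1 : R)) (is_derive_id (0 : R) (1 : R))) _.
    by rewrite add0r.
  have h2 : is_derive (0 : R) (1 : R) (fun s => level (phi + s)) (- ((1 + phi ^+ 2)^-1 / 4)).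
    have := @is_derive_level _ (phi + 0) => h.
    have := is_derive1_comp h h1; rewrite mulr1 addr0; exact.
  have h3 : is_derive (0 : R) (1 : R) (fun s => a - level (phi + s)) ((1 + phi ^+ 2)^-1 / 4).
    by apply: is_derive_eq (is_deriveB (is_derive_cst a (0 : R) (1 : R)) h2) _; rewrite sub0r opprK.
  have h4 := @is_derive_flat _ 0 (a - level (phi + 0)).
  by have := @is_derive1_comp _ (flat 0) (fun s => a - level (phi + s)) 0 _ _ h4 h3; rewrite mul0r subr0 addr0; exact.
have [_ _ estG] := is_derive_fder dG.
have [C C0 flip1] := flow_lip_near A; have cvf := lip_cvg C0 flip1.
(* Two errors of size [d / 4 * |s|] cannot make up for the growth [d * s]. *)
have d1 : 0 < d / (4 * (C + 1)) by rewrite divr_gt0// mulr_gt0// ltr_wpDl.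
have d4 : 0 < d / 4 by rewrite divr_gt0.
have near1 : \forall s \near (0 : R),
    `|tube_fun (flow x phi s) - tube_fun x| <= d / 4 * `|s|.
  have est2 : \forall y \near flow x phi 0, forall v, `|tube_fun y - tube_fun x - L (v, y - x)| <=
      d / (4 * (C + 1)) * (w1 v * `|y - x|) by rewrite (flow0 A); exact: estL.
  have est3 : \forall s \near (0 : R), forall v,
    `|tube_fun (flow x phi s) - tube_fun x - L (v, flow x phi s - x)|
    <= d / (4 * (C + 1)) * (w1 v * `|flow x phi s - x|) by exact: (cvf _ est2).
  near=> s.
  have : forall v, `|tube_fun (flow x phi s) - tube_fun x - L (v, flow x phi s - x)|
    <= d / (4 * (C + 1)) * (w1 v * `|flow x phi s - x|) by near: s.
  move=> /(_ tt); rewrite L0 subr0 => /le_trans; apply; rewrite /w1 mul1r.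
  have : `|flow x phi s - flow x phi 0| <= C * `|s - 0| by near: s.
  rewrite (flow0 A) subr0 => h.
  apply: le_trans (ler_wpM2l (ltW d1) h) _.
  have -> : d / 4 * `|s| = d / (4 * (C + 1)) * ((C + 1) * `|s|).
    by field; rewrite gt_eqF// ltr_wpDl.
  by apply: (ler_wpM2l (ltW d1)); apply: ler_wpM2r => //; rewrite lerDl.
have near2 : \forall s \near (0 : R), `|G s - G 0 - d * s| <= d / 4 * `|s|.
  by apply: filterS (estG _ d4) => s /(_ tt); rewrite /w1 mul1r /= subr0.
have near3 : \forall s \near (0 : R), tube_fun (flow x phi s) = G s.
  near=> s; apply: tube_fun_flow => //.
  have E : phi + s - phi = s by ring.
  have h1 := @level_lip _ (phi + s) phi; rewrite E in h1.
  have h2 : `|s - 0| <= (a - level phi) / 2 by near: s; apply: (@near_le1 R R); lra.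
  rewrite subr0 in h2; have := ler_norm (level (phi + s) - level phi).
  by rewrite -/a; lra.
have /nbhs_normP[e0 /= e00 P] : \forall s \near (0 : R),
   [/\ `|tube_fun (flow x phi s) - tube_fun x| <= d / 4 * `|s|,
       `|G s - G 0 - d * s| <= d / 4 * `|s| & tube_fun (flow x phi s) = G s].
  by near=> s; split; near: s.
have se : `|0 - (e0 / 2)| < e0 by rewrite sub0r normrN gtr0_norm; lra.
have [q1 q2 q3] := P _ se.
have G0 : tube_fun x = G 0 by rewrite /G addr0 fE.
rewrite q3 G0 in q1; have eh : 0 < e0 / 2 by rewrite divr_gt0.
rewrite (gtr0_norm eh) in q1 q2.
have := ler_norm (- (G (e0 / 2) - G 0 - d * (e0 / 2))); rewrite normrN.
have := ler_norm (G (e0 / 2) - G 0); have := mulr_gt0 d0 eh; lra.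
Unshelve. all: by end_near. Qed.

(** A zero [x] on a branch has [bump - level <= 0]. Flowing backwards keeps [bump] and raises
    [level], so points arbitrarily close to [x] have a strictly negative argument; the function
    vanishes around them, and they are outside the support. *)
Lemma interior_supp_tube_fun x : (forall y, Ck 0 bump y) ->
  interior (supp tube_fun) x -> tube_fun x != 0.
Proof.
move=> Cbt ix; apply/eqP => fx0.
have notsupp y : (\forall z \near y, tube_fun z = 0) -> ~ supp tube_fun y.
  by move=> nz /(_ _ nz)[z [/= /eqP]].
have [f0|[phi0 f1]] := tube_fun_local x.
  exact: notsupp f0 (interior_subset ix).
have [a0 fE] := nbhs_singleton f1.
have A := is_angle_angle_near a0; set phi := angle_near phi0 x in A fE.
have A0 : bump (Phi x phi) - level phi <= 0.
  rewrite leNgt; apply/negP => /(flat_gt0 0); rewrite -/(tube_val x phi) -fE fx0.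
  by rewrite ltxx.
have [C C0 flip] := flow_lip_near A; have := lip_cvg C0 flip; rewrite (flow0 A) => cvf.
have f2 : \forall y \near x, supp tube_fun y /\
    \forall z \near y, 0 < radial phi0 z /\ tube_fun z = tube_val z (angle_near phi0 z).
  by near=> y; split; near: y; [exact: ix|exact: near_join].
have /nbhs_normP[d /= d0 P] := cvf _ f2.
pose t := Num.min 1 (d / 2).
have t0 : 0 < t by rewrite lt_min ltr01 divr_gt0.
have t1 : t <= 1 by rewrite /t ge_min lexx.
have td : t <= d / 2 by rewrite /t ge_min lexx orbT.
have hb : `|0 - - t| < d by rewrite sub0r opprK gtr0_norm; lra.
have [sy fy] := P _ hb.
set y := flow x phi (- t) in sy fy.
have [ay _] := nbhs_singleton fy.
have Ay : is_angle y (phi - t) by exact: is_angle_flow A.2.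
(* Both are angles of [y], at distance less than [pi / 2 + pi / 2 + 1], which is below [2 * pi]. *)
have lE : angle_near phi0 y = phi - t.
  apply: (is_angle_unique Ay (is_angle_angle_near ay)).
  have h1 := angle_near_lt_pihalf phi0 y; have h2 := angle_near_lt_pihalf phi0 x; rewrite -/phi in h2.
  have := ler_normD (angle_near phi0 y - phi0) (phi0 - (phi - t)).
  have := ler_normD (phi0 - phi) t; rewrite subrKA (distrC phi0) (gtr0_norm t0).
  have -> : phi0 - (phi - t) = phi0 - phi + t by ring.
  by have := pi_ge2 R; lra.
have Fy : bump (Phi y (angle_near phi0 y)) - level (angle_near phi0 y) < 0.
  rewrite lE /y (Phi_flow _ A); have /level_lt : phi - t < phi by lra.
  lra.
have Fn : \forall z \near y, bump (Phi z (angle_near phi0 z)) - level (angle_near phi0 z) < 0.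
  exact: (Ck_cvg (@Ck_tube_arg 0 phi0 y Cbt ay)) _ (lt_nbhsl Fy).
apply: (notsupp y) sy; near=> z.
have [_ ->] : 0 < radial phi0 z /\ tube_fun z = tube_val z (angle_near phi0 z) by near: z.
by apply: flat_le0; apply: ltW; near: z.
Unshelve. all: by end_near. Qed.

Lemma tube_fun_01 x : 0 <= tube_fun x <= 1.
Proof. by rewrite flat_ge0 (flat_le 0). Qed.

Lemma tube_fun_nz : exists x, tube_fun x != 0.
Proof.
(* The centre of the coil at angle 2, where [bump] takes its value 9/10 at the origin. Since
   [atan 2 > pi / 4 >= 1/2], [level 2] is below 7/8. *)
pose x := cos 2 *: u1 + sin 2 *: u2 + drift 2.
have := cos2Dsin2 (2 : R); rewrite !expr2 => E.
have h1 : xi1 x = cos 2.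
  by rewrite /x !(contractive_formD _ _ c1) !(contractive_formZ _ _ c1) xi1_drift x11 x12; ring.
have h2 : xi2 x = sin 2.
  by rewrite /x !(contractive_formD _ _ c2) !(contractive_formZ _ _ c2) xi2_drift x21 x22; ring.
have A : is_angle x 2 by rewrite /is_angle /transversal /radial h1 h2; split; [ring|rewrite E].
have P0 : Phi x 2 = 0.
  rewrite /Phi /rho2 h1 h2 E subrr mulr0 scale0r addr0 /zpart h1 h2 /x.
  move: (_ *: u1) (_ *: u2) (drift 2) => p q t.
  by rewrite [p + q + t]addrC [p + q]addrC addrA !addrK subrr.
have Hx : tube_val x 2 != 0.
  rewrite /tube_val P0 bump_at0 gt_eqF// flat_gt0// /level.
  have : atan 1 < atan (2 : R) by apply: lt_atan; lra.
  by rewrite atan1; have := pi_ge2 R; lra.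
by exists x; rewrite (tube_funE A Hx).
Qed.

Lemma tube_fun_bounded : exists M, forall x, tube_fun x != 0 -> `|x| <= M.
Proof.
exists (rad + gap * expR 2 * 4 + 6) => x /tube_fun_angle[phi [A Hx _]].
have h1 := tube_val_zpart Hx; have h2 := tube_val_rho2 Hx; have p0 := tube_val_angle_gt0 Hx.
have h3 : `|drift phi| <= gap * expR 2 * 4 := sigma_le gap_ge0 en phi.
have s1 := sqr_ge0 (xi1 x); have s2 := sqr_ge0 (xi2 x).
rewrite !expr2 in s1 s2; rewrite /rho2 ler_norml in h2.
have sq (a : R) : a * a <= 5 / 4 -> `|a| <= 2.
  by move=> aa; rewrite ler_norml; apply/andP; split; nra.
have k1 : `|xi1 x| <= 2 by apply: sq; lra.
have k2 : `|xi2 x| <= 2 by apply: sq; lra.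
have -> : x = (zpart x - drift phi) + drift phi + xi1 x *: u1 + xi2 x *: u2.
  rewrite subrK /zpart; move: (_ *: u1) (_ *: u2) => p q.
  by rewrite [x - p - q + p]addrAC !subrK.
have := ler_normD (zpart x - drift phi + drift phi + xi1 x *: u1) (xi2 x *: u2).
have := ler_normD (zpart x - drift phi + drift phi) (xi1 x *: u1).
have := ler_normD (zpart x - drift phi) (drift phi); rewrite !normrZ.
have := ler_pM (normr_ge0 _) (normr_ge0 _) k1 u1n.
have := ler_pM (normr_ge0 _) (normr_ge0 _) k2 u2n; lra.
Qed.

Lemma tube_fun_bump : is_bump tube_fun.
Proof.
split; first exact: tube_fun_nz.
have [M bM] := tube_fun_bounded; exists M => x sx.
rewrite leNgt; apply/negP => Mx.
have d0 : 0 < (`|x| - M) / 2 by lra.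
have [y [/= fy xy]] := sx _ (near_le1 x d0).
have := bM _ fy; have := ler_normD (x - y) y; rewrite subrK (distrC x); lra.
Qed.

Lemma angle_near_lip phi x y : is_angle x phi -> 1 / 2 < radial phi y ->
  `|angle_near phi y - phi| <= 4 * `|y - x|.
Proof.
move=> [b0 _] ay; have aly : 0 < radial phi y by lra.
have -> : angle_near phi y - phi = atan (transversal phi y / radial phi y) - atan 0.
  by rewrite /angle_near atan0 addrAC subrr add0r subr0.
apply: le_trans (atan_lip _ _) _; rewrite subr0 normrM normfV (gtr0_norm aly).
rewrite ler_pdivrMr//; have := transversal_lip phi y x; rewrite b0 subr0 => h.
have := normr_ge0 (y - x); nra.
Qed.

Lemma rho2_lip x y : rho2 x <= 5 / 4 -> `|y - x| <= 1 ->
  `|rho2 y - rho2 x| <= 10 * `|y - x|.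
Proof.
move=> rx yx.
have s1 := sqr_ge0 (xi1 x); have s2 := sqr_ge0 (xi2 x).
rewrite !expr2 in s1 s2; rewrite /rho2 in rx.
have sq (a b : R) : a * a <= 5 / 4 -> `|b - a| <= `|y - x| -> `|b * b - a * a| <= 5 * `|y - x|.
  move=> aa ba; have a2 : `|a| <= 2 by rewrite ler_norml; apply/andP; split; nra.
  have -> : b * b - a * a = (b - a) * (b - a + a + a) by ring.
  rewrite normrM mulrC.
  have h : `|b - a + a + a| <= 5.
    by have := ler_normD (b - a + a) a; have := ler_normD (b - a) a; lra.
  exact: ler_pM.
have k1 : `|xi1 y * xi1 y - xi1 x * xi1 x| <= 5 * `|y - x|.
  by apply: sq; [lra|rewrite -(contractive_formB _ _ c1); exact: c1.2].
have k2 : `|xi2 y * xi2 y - xi2 x * xi2 x| <= 5 * `|y - x|.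
  by apply: sq; [lra|rewrite -(contractive_formB _ _ c2); exact: c2.2].
have -> : rho2 y - rho2 x = (xi1 y * xi1 y - xi1 x * xi1 x) + (xi2 y * xi2 y - xi2 x * xi2 x).
  by rewrite /rho2; ring.
by have := ler_normD (xi1 y * xi1 y - xi1 x * xi1 x) (xi2 y * xi2 y - xi2 x * xi2 x); lra.
Qed.

Lemma tube_fun_lip_at Lb : 0 <= Lb ->
  (forall x y, `|bump x - bump y| <= Lb * `|x - y|) ->
  exists2 L, 0 <= L & forall x, tube_fun x != 0 ->
    \forall y \near x, `|tube_fun y - tube_fun x| <= L * `|y - x|.
Proof.
move=> Lb0 btlip; have k0 := kappa_gt0; have L0 := drift_const_ge0.
(* Contributions of [zpart], of the radial term (10 from [rho2], 2 from [|u1|]), and of the drift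
   along an angle that is 4-Lipschitz at [x]. *)
pose DP := 4 + 20 * kappa + 4 * drift_const.
have DP0 : 0 <= DP by rewrite /DP; lra.
exists (2 * (Lb * DP + 4)).
  by have := mulr_ge0 Lb0 DP0; lra.
move=> x fx; have [phi [A Hx fE]] := tube_fun_angle fx.
have ax : 1 / 2 < radial phi x.
  have := tube_val_rho2 Hx; rewrite ler_norml -(radial_transversal_sq phi) A.1 mul0r addr0.
  by have := A.2; nra.
have rx : rho2 x <= 5 / 4.
  by have := tube_val_rho2 Hx; rewrite ler_norml; lra.
near=> y.
have xy : `|zpart x - zpart y| <= 1 by near: y; exact: near_zpart.
have ay : 1 / 2 < radial phi y by near: y; exact: near_radial.
have yx : `|y - x| <= 1 / 4 by near: y; apply: near_le1; lra.
have ay0 : 0 < radial phi y by lra.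
have hl := angle_near_lip A ay.
have hr : `|rho2 y - rho2 x| <= 10 * `|y - x| by apply: rho2_lip => //; lra.
have hs : `|drift (angle_near phi y) - drift phi| <= drift_const * (4 * `|y - x|).
  apply: le_trans (drift_lip _) _; first lra.
  exact: ler_wpM2l.
have hP : `|Phi y (angle_near phi y) - Phi x phi| <= DP * `|y - x|.
  have -> : Phi y (angle_near phi y) - Phi x phi =
     zpart (y - x) + (kappa * (rho2 y - rho2 x)) *: u1 - (drift (angle_near phi y) - drift phi).
    have -> : kappa * (rho2 y - rho2 x) = kappa * (rho2 y - 1) - kappa * (rho2 x - 1) by ring.
    rewrite scalerBl -zpartB /Phi.
    move: (zpart y) (zpart x) (_ *: u1) (_ *: u1) (drift _) (drift _) => z z' p p' t t'.
    have B (a b c d : X) : (a - b) - (c - d) = (a - c) - (b - d).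
      by rewrite !opprB addrACA [RHS]addrACA [- b - c]addrC.
    by rewrite B opprD addrACA.
  have h1 := zpart_le (y - x).
  have h2 : `|(kappa * (rho2 y - rho2 x)) *: u1| <= kappa * (10 * `|y - x|) * 2.
    rewrite normrZ normrM (gtr0_norm k0); apply: ler_pM => //.
      by rewrite mulr_ge0// ltW.
    by rewrite ler_pM2l.
  have := ler_normB (zpart (y - x) + (kappa * (rho2 y - rho2 x)) *: u1) (drift (angle_near phi y) - drift phi).
  have := ler_normD (zpart (y - x)) ((kappa * (rho2 y - rho2 x)) *: u1).
  rewrite /DP; lra.
rewrite (tube_fun_angle_near A Hx xy ay0) fE /tube_val.
apply: le_trans (flat0_lip _ _) _; rewrite -mulrA; apply: ler_wpM2l => //.
have -> : bump (Phi y (angle_near phi y)) - level (angle_near phi y) - (bump (Phi x phi) - level phi) =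
  (bump (Phi y (angle_near phi y)) - bump (Phi x phi)) - (level (angle_near phi y) - level phi) by ring.
apply: le_trans (ler_normB _ _) _; rewrite mulrDl; apply: lerD.
  by apply: le_trans (btlip _ _) _; rewrite -mulrA; exact: ler_wpM2l.
exact: le_trans (level_lip _ _) hl.
Unshelve. all: by end_near. Qed.

End Tube.

(** * Global Lipschitz bound, normalisation of the given bump, and assembly *)

Section Conclusion.
Context {R : realType} {X : normedModType R}.

Lemma fder_diff (f : X -> R) x L :
  fder w1 (fun y _ => f y) x L -> 'd f x = (fun h => L (tt, h)) :> (X -> R).
Proof.
move=> [lin [_ [C C0 bL]] est].
have linL : linear (fun h => L (tt, h)) by move=> a h k; rewrite lin.
pose dfm : {linear X -> R} :=
  HB.pack (fun h => L (tt, h)) (GRing.isLinear.Build R X R *:%R _ linL).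
apply: (@diff_unique _ _ _ f dfm x).
  move=> h; apply: (@lip_cvg _ _ _ _ _ C C0); apply: nearW => k.
  have dB : dfm k - dfm h = L (tt, k - h) by rewrite -linearB.
  by rewrite dB; apply: le_trans (bL _) _; rewrite /dweight /w1 /= mul1r.
apply/eqaddoP => e e0.
have E : \forall h \near (0 : X), forall v, `|f (h + x) - f x - L (v, h + x - x)| <= e * (w1 v * `|h + x - x|).
  have cx : h + x @[h --> (0 : X)] --> x.
    by rewrite -[X in _ --> X]add0r; apply: cvgD; [exact: cvg_id|exact: cvg_cst].
  exact: (cx _ (est e e0)).
apply: filterS E => h /(_ tt); rewrite /w1 mul1r addrK !fctE /= opprD addrA.
by [].
Qed.

Lemma is_derive_le (g : R -> R) (c d M : R) : is_derive c 1 g d ->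
  (\forall s \near c, `|g s - g c| <= M * `|s - c|) -> `|d| <= M.
Proof.
move=> /is_derive_fder[_ _ est] gM; apply/ler_addgt0Pr => e e0.
have /nbhs_normP[r /= r0 P] : \forall s \near c,
    `|g s - g c| <= M * `|s - c| /\ `|g s - g c - d * (s - c)| <= e * `|s - c|.
  near=> s; split; first by near: s.
  suff : forall v, `|g s - g c - d * (s - c)| <= e * (w1 v * `|s - c|).
    by move=> /(_ tt); rewrite /w1 mul1r.
  by near: s; exact: est.
have r2 : 0 < r / 2 by rewrite divr_gt0.
have E : c + r / 2 - c = r / 2 by ring.
have hb : `|c - (c + r / 2)| < r by rewrite distrC E gtr0_norm//; lra.
have [h1 h2] := P _ hb.
rewrite E (gtr0_norm r2) in h1 h2; rewrite -(ler_pM2r r2) -{1}(gtr0_norm r2) -normrM.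
have := ler_normB (g (c + r / 2) - g c) (g (c + r / 2) - g c - d * (r / 2)).
have -> : g (c + r / 2) - g c - (g (c + r / 2) - g c - d * (r / 2)) = d * (r / 2) by ring.
lra.
Unshelve. all: by end_near. Qed.

(* Zeros of f are minima, so the derivative of f vanishes there. *)
Lemma lipschitz_of_local (f : X -> R) L : 0 <= L ->
  (forall x, 0 <= f x) -> (forall x, Ck 1 f x) ->
  (forall x, f x != 0 -> \forall y \near x, `|f y - f x| <= L * `|y - x|) ->
  lipschitz_fun f.
Proof.
move=> L0 f0 Cf fL; exists L => a b.
pose l (t : R) : X := b + t *: (a - b).
pose g (t : R) : R := f (l t).
have vl t : vder l t (fun s => s *: (a - b)).
  split.
  - by move=> c h k; rewrite scalerDl scalerA.
  - by exists `|a - b| => // h; rewrite normrZ mulrC.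
  move=> e e0; apply: filterE => s.
  have -> : l s - l t - (s - t) *: (a - b) = 0.
    by rewrite /l scalerBl opprD addrACA subrr add0r subrr.
  by rewrite normr0 mulr_ge0// ltW.
have lB s t : l s - l t = (s - t) *: (a - b).
  by rewrite /l scalerBl opprD addrACA subrr add0r.
have clt t : l s @[s --> t] --> l t.
  have [C C0 lip] := vder_lip (vl t); exact: lip_cvg C0 lip.
have /choice[g' dg] : forall t, exists d, is_derive t (1 : R) g d.
  move=> t; have [_ _ [F' /nbhs_singleton dF _]] := Cf (l t).
  exists (F' (l t) (tt, 1 *: (a - b))).
  have dg := fder_comp (@w1_ge0 R) dF (vl t).
  have := @fder_is_derive R R _ _ _ _ _ tt 1 (@w1_ge0 R) dg.
  exact.
have derg t : derivable g t 1 by exact: (@ex_derive _ _ _ _ _ _ _ (dg t)).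
have [c _] := MVT ltr01 (fun t _ => dg t) (continuous_subspaceT
  (fun t => differentiable_continuous (proj1 (derivable1_diffP g t) (derg t)))).
have -> : g 1 = f a by rewrite /g /l scale1r addrC subrK.
have -> : g 0 = f b by rewrite /g /l scale0r addr0.
rewrite subr0 mulr1 => ->.
have [gc|gc] := eqVneq (g c) 0.
  have d0 : is_derive c 1 g 0.
    apply: (@derive1_at_min _ g (c - 1) (c + 1)) => //; first lra.
      by rewrite in_itv /=; apply/andP; split; lra.
    by move=> t _; rewrite gc; exact: f0.
  rewrite -(@derive_val _ _ _ _ _ _ _ (dg c)) (@derive_val _ _ _ _ _ _ _ d0).
  by rewrite normr0 mulr_ge0.
apply: (is_derive_le (dg c)).
have near_c : \forall s \near c, `|g s - g c| <= L * `|l s - l c|.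
  exact: (clt c _ (fL _ gc)).
apply: filterS near_c => s; rewrite lB normrZ.
by rewrite [`|s - c| * _]mulrC mulrA.
Qed.

(** A smooth 1-Lipschitz map to [0, 1) that vanishes only at 0, so it shrinks the range of a bump
    and keeps its support and regularity. *)
Definition squash (t : R) : R := t * t * (1 + t * t)^-1.

Lemma one_plus_sq (t : R) : 0 < 1 + t * t.
Proof. by rewrite ltr_wpDr// -expr2 sqr_ge0. Qed.

Lemma squash_ge0 t : 0 <= squash t.
Proof. by rewrite /squash mulr_ge0 -?expr2 ?sqr_ge0// invr_ge0 addr_ge0// sqr_ge0. Qed.

Lemma squash_lt1 t : squash t < 1.
Proof. by rewrite /squash ltr_pdivrMr ?one_plus_sq// mul1r; lra. Qed.

Lemma squash_lip s t : `|squash s - squash t| <= `|s - t|.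
Proof.
have ps := one_plus_sq s; have pt := one_plus_sq t.
have -> : squash s - squash t = (s - t) * ((s + t) / ((1 + s * s) * (1 + t * t))).
  by rewrite /squash; field; rewrite !gt_eqF.
rewrite normrM -[leRHS]mulr1; apply: ler_wpM2l => //.
rewrite normrM normfV (gtr0_norm (mulr_gt0 ps pt)) ler_pdivrMr ?mulr_gt0// mul1r.
rewrite ler_norml; apply/andP; split.
  by have := sqr_ge0 (s + 1); have := sqr_ge0 (t + 1); have := sqr_ge0 (s * t); rewrite !expr2; nra.
by have := sqr_ge0 (s - 1); have := sqr_ge0 (t - 1); have := sqr_ge0 (s * t); rewrite !expr2; nra.
Qed.

Lemma Ck_squash k (t : R) : Ck k squash t.
Proof.
have Csq : Ck k (fun t : R => t * t) t by apply: Ck_mul; exact: Ck_id.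
apply: Ck_mul => //; apply: (@Ck_comp _ _ _ (fun s : R => s^-1) (fun t : R => 1 + t * t)).
  by apply: Ck_inv; rewrite gt_eqF// one_plus_sq.
by apply: Ck_add => //; exact: Ck_cst.
Qed.

Lemma normalized_bump (b : X -> R) : is_bump b ->
  exists bt : X -> R, exists2 r, 0 <= r &
    [/\ forall x, 0 <= bt x, forall x, bt x < 1,
        forall x, bt x != 0 -> `|x| <= r, bt 0 = 9 / 10 &
        (forall k, (forall x, Ck k b x) -> forall x, Ck k bt x) /\
        (lipschitz_fun b -> lipschitz_fun bt)].
Proof.
move=> [[x0 bx0] [M bM]].
(* Translation moves a nonzero value of [b] to the origin; the scaling turns it into 3, and
   [squash 3 = 9/10]. *)
exists (fun x => squash (3 / b x0 * b (x + x0))); exists (`|M| + `|x0|); first by rewrite addr_ge0.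
split.
- by move=> x; exact: squash_ge0.
- by move=> x; exact: squash_lt1.
- move=> x sx; have bx : b (x + x0) != 0.
    by apply: contra_neq sx => ->; rewrite /squash mulr0 !mul0r.
  have := bM _ (@subset_closure _ [set x | b x != 0] _ bx).
  have := ler_normB (x + x0) x0; rewrite addrK; have := ler_norm M; lra.
- by rewrite add0r divfK// /squash; field.
split=> [k Cb x|[L bL]].
  apply: (@Ck_comp _ _ _ squash (fun y => 3 / b x0 * b (y + x0))).
    exact: Ck_squash.
  apply: Ck_mul; first exact: Ck_cst.
  apply: (@Ck_near _ _ _ (fun y => b (id y + \sum_(i < 1) (1 : R) *: x0))).
    by apply: nearW => y; rewrite big_ord1 scale1r.
  apply: (@Ck_family_comp _ _ _ k 1 _ w1 (fun y _ => b y) id (fun _ _ => 1) (fun=> x0) x 1) => //.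
  + by move=> h; rewrite mul1r.
  + by move=> _; exact: Ck_cst.
  exact: Cb.
exists (`|3 / b x0| * L) => x y.
apply: le_trans (squash_lip _ _) _; rewrite -mulrBr normrM -mulrA ler_wpM2l//.
by apply: le_trans (bL _ _) _; rewrite opprD addrACA subrr addr0.
Qed.

Lemma lipschitz_const_ge0 (f : X -> R) : lipschitz_fun f ->
  exists2 L, 0 <= L & forall x y, `|f x - f y| <= L * `|x - y|.
Proof.
move=> [L fL]; exists `|L| => // x y; apply: le_trans (fL x y) _.
by apply: ler_wpM2r => //; exact: ler_norm.
Qed.

Lemma bump_without_critical_points p (b : X -> R) :
  infinite_dimensional X -> valid_order p -> Cp_smooth p b -> is_bump b ->
  exists f : X -> R, Cp_smooth p f /\ is_bump f /\ (forall x, 0 <= f x <= 1) /\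
    (forall x, interior (supp f) x -> 'd f x != 0 :> (X -> R)) /\
    (lipschitz_fun b -> lipschitz_fun f).
Proof.
move=> dimX p1 Cb bb.
have [bt [r r0 [bt0 bt1 btr bt00 [Cbt lbt]]]] := normalized_bump bb.
have [E [xi [cxi En xiE xik]]] := semibiorthogonal dimX.
(* The sequence is only triangular; this correction makes the pair [u1], [E 1] dual to [xi 0],
   [xi 1] and costs at most a factor 2 in the norm. The vectors from index 2 on lie in the kernels
   of both forms and carry the drift. *)
pose u1 := E 0%N - xi 1%N (E 0%N) *: E 1%N.
have c1 := cxi 0%N; have c2 := cxi 1%N.
have x11 : xi 0%N u1 = 1.
  by rewrite (contractive_formB _ _ c1) (contractive_formZ _ _ c1) xiE (xik 0%N 1%N)// mulr0 subr0.
have x12 : xi 0%N (E 1%N) = 0 by exact: xik.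
have x21 : xi 1%N u1 = 0.
  by rewrite (contractive_formB _ _ c2) (contractive_formZ _ _ c2) xiE mulr1 subrr.
have x22 := xiE 1%N.
have u1n : `|u1| <= 2.
  apply: le_trans (ler_normB _ _) _; rewrite normrZ !En mulr1.
  by have := c2.2 (E 0%N); rewrite En; lra.
have u2n : `|E 1%N| <= 1 by rewrite En.
have e1 i : xi 0%N (E i.+2) = 0 by exact: xik.
have e2 i : xi 1%N (E i.+2) = 0 by exact: xik.
have en i : `|E i.+2| <= 1 by rewrite En.
have cz i : contractive_form (xi i.+2) by exact: cxi.
have ze i : xi i.+2 (E i.+2) = 1 by exact: xiE.
have zk j n : (j < n)%N -> xi j.+2 (E n.+2) = 0 by move=> jn; exact: xik.
pose f := tube_fun (xi 0%N) (xi 1%N) u1 (E 1%N) (fun i => E i.+2) bt r.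
have Ckbt k : le_order k p -> forall x, Ck k bt x.
  by move=> kp; apply: Cbt => x; exact: Cp_smooth_Ck Cb kp.
have le1p : le_order 1 p by case: p p1 {Cb Ckbt}.
have Ckf k : le_order k p -> forall x, Ck k f x.
  move=> kp x; apply: (@Ck_tube_fun _ _ _ _ _ _ (fun i => E i.+2) (fun i => xi i.+2) c1 c2 x11 x12 u1n u2n e1 en cz ze zk bt r r0 bt1 btr k x (Ckbt k kp)).
have f01 x : 0 <= f x <= 1 by exact: tube_fun_01.
exists f; split; first by apply: Ck_Cp_smooth => k x kp; exact: Ckf.
split; first exact: (@tube_fun_bump _ _ _ _ _ _ (fun i => E i.+2) (fun i => xi i.+2) c1 c2 x11 x12 x21 x22 u1n u2n e1 e2 en cz ze zk bt r r0 bt1 btr bt00).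
split=> //; split.
  move=> x ix.
  have fx : f x != 0.
    have Cb0 : forall y, Ck 0 bt y by apply: Ckbt; case: (p).
    exact: (@interior_supp_tube_fun _ _ _ _ _ _ (fun i => E i.+2) (fun i => xi i.+2)
      c1 c2 x11 x12 x21 x22 u1n u2n e1 e2 en cz ze zk bt r r0 bt1 btr x Cb0 ix).
  have [_ _ [F' /nbhs_singleton dF _]] := Ckf _ le1p x.
  have [h hL] := @tube_fun_der_neq0 _ _ _ _ _ _ (fun i => E i.+2) (fun i => xi i.+2) c1 c2 x11 x12 x21 x22 u1n u2n e1 e2 en cz ze zk bt r r0 bt1 btr x _ fx dF.
  rewrite (fder_diff dF); apply: contra_neq hL => H0.
  exact: (congr1 (fun g => g h) H0).
move=> /lbt/lipschitz_const_ge0[Lb Lb0 btL].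
have [L L0 fL] := @tube_fun_lip_at _ _ _ _ _ _ (fun i => E i.+2) (fun i => xi i.+2) c1 c2 x11 x12 u1n u2n e1 en cz ze zk bt r r0 bt1 btr Lb Lb0 btL.
apply: (lipschitz_of_local L0) => //; last exact: Ckf.
by move=> x; have /andP[] := f01 x.
Qed.

End Conclusion.

Theorem theorem1p1 (R : realType) (X : completeNormedModType R)
  (p : smooth_order) :
  infinite_dimensional X -> valid_order p ->
  ((exists b : X -> R, Cp_smooth p b /\ is_bump b) ->
     exists f : X -> R, Cp_smooth p f /\ is_bump f /\
       (forall x, 0 <= f x <= 1) /\
       (forall x, interior (supp f) x -> 'd f x != 0 :> (X -> R))) /\
  ((exists b : X -> R, Cp_smooth p b /\ is_bump b /\ lipschitz_fun b) ->
     exists f : X -> R, Cp_smooth p f /\ is_bump f /\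
       (forall x, 0 <= f x <= 1) /\
       (forall x, interior (supp f) x -> 'd f x != 0 :> (X -> R)) /\
       lipschitz_fun f).
Proof.
move=> dimX p1; split=> [[b [Cb bb]]|[b [Cb [bb lb]]]].
  have [f [Cf [bf [f01 [df _]]]]] := bump_without_critical_points dimX p1 Cb bb.
  by exists f.
have [f [Cf [bf [f01 [df lf]]]]] := bump_without_critical_points dimX p1 Cb bb.
by exists f; do 4 split=> //; exact: lf.
Qed.
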